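(* Consider the many-server system described in the context, operated under any load balancing policy in the class LB-zero. Let $\theta_m = \frac{6\mu_1 v_m + 5(m-1)v_m}{C}$ for $1\le m\le M$. If $N$ satisfies $$\min\left\{\sum_{m=1}^M\theta_m,\ \frac{C(1-\xi)}{2\mu_1 C_M}\right\} N^{0.5-\alpha} \;\geq\; \log N \;\geq\; \max\left\{\frac{2\mu_1}{1-\xi},\ \frac{C}{\mu_1}\right\},$$ then for every $1\le m\le M$, $$\mathbb P\left(s_{1,m}^* - \frac{\theta_m\log N}{\sqrt{N}}\leq S_{1,m} \leq s_{1,m}^* + \frac{1}{N^\alpha} + \frac{\sum_{r\neq m}\theta_r\log N}{\sqrt{N}}\right) \geq 1-\frac{M}{N^3},$$ where $s^*_{1,m}=\lambda v_m$.
   Context: System: $N$ identical servers, each able to hold at most $b$ jobs ($b\ge 1$ finite: one in service, at most $b-1$ waiting), served FIFO; a job routed to a server already holding $b$ jobs is discarded. Jobs arrive as a Poisson process of rate $\lambda N$ with $\lambda = 1-N^{-\alpha}$, $0<\alpha<1/2$. Service times are i.i.d. Coxian with $M$ phases: phase $m$ lasts an exponential time with rate $\mu_m>0$; after completing phase $m<M$ the job enters phase $m+1$ with probability $p_m\in[0,1)$ and otherwise departs; after phase $M$ it departs. Let $v_m=\prod_{i=1}^{m-1}p_i/\mu_m$ (empty product $=1$), normalized so that $\sum_{m=1}^M v_m=1$; $\bar v=\min_m v_m$. State: $S_{i,m}(t)$ is the fraction of servers holding at least $i$ jobs whose job in service is in phase $m$, $S_i(t)=\sum_m S_{i,m}(t)$.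 A load balancing policy routes each arriving job based on the current state matrix $(S_{i,m}(t))$, and it is assumed the resulting finite-state CTMC is irreducible; $S=(S_{i,m})$ denotes a random matrix with its stationary distribution and $S_i=\sum_m S_{i,m}$. For a state $s$, $s_1=\sum_m s_{1,m}$ and $A_1(s)$ is the probability an incoming job is routed to a busy server given the state is $s$. LB-zero is the class of policies with $A_1(s)\le 1/\sqrt N$ for every possible state $s$ with $s_1\le 1-\frac{1}{N^\alpha\log N}$. Constants: for $2\le m\le M$, $a_m=\frac{\mu_m}{p_1\mu_1+\mu_m}$, $b_m=(1-a_m)\bigl(1+\sum_{r=m+1}^M \frac{v_r}{v_1}\bigr)-\frac{a_m v_m}{v_1}$, $c_m = 5(1-a_m)\sum_{r=m+1}^M (r-1)v_r + 5a_m \sum_{r=2}^{m-1} \frac{\mu_r v_r}{\mu_m} + 5(m-2)a_m v_m + 5 - a_m$; $\xi=\sum_{m=2}^M b_m\prod_{j=m+1}^M a_j$, $C_M=\sum_{m=2}^M c_m\prod_{j=m+1}^M a_j$ (empty sum $0$, empty product $1$); the paper asserts $0<\xi<1$, and $C=\sqrt{\frac{2\bar v^2\log(1/\xi)}{3M+(3M+4)\log(1/\xi)}}$.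
   Formalization: The assertion 0<ξ<1 is taken as a hypothesis: for M=1 and M=2 the given formula yields ξ=0, so log(1/ξ), C and θ_m are undefined, and these cases are excluded. *)

(* Defs.v *)
From HB Require Import structures.
From mathcomp Require Import all_boot all_order all_algebra.
From mathcomp Require Import all_classical all_reals all_analysis.
Set Implicit Arguments. Unset Strict Implicit. Unset Printing Implicit Defensive.
Import Order.TTheory GRing.Theory Num.Theory.
Local Open Scope ring_scope.

(* Aggregate state of the N-server system: for each class (q, m), with
   q : 'I_b standing for "exactly q+1 jobs" and m : 'I_M standing for
   "job in service is in phase m+1", the number of servers in that class.
   Idle servers are N - busy x.  This is in bijection with the occupancy
   matrix (S_{i,m}) of the paper (see Sim below). *)
Notation state N b M := {ffun 'I_b * 'I_M -> 'I_N.+1}.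

Definition busy {N b M : nat} (x : state N b M) : nat :=
  (\sum_(k : 'I_b * 'I_M) (x k : nat))%N.

Definition valid {N b M : nat} (x : state N b M) : bool := (busy x <= N)%N.

Definition incr {N b M : nat} (x : state N b M) (k : 'I_b * 'I_M) : state N b M :=
  [ffun k' => if k' == k then inord (x k').+1 else x k'].
Definition decr {N b M : nat} (x : state N b M) (k : 'I_b * 'I_M) : state N b M :=
  [ffun k' => if k' == k then inord (x k').-1 else x k'].

(* arrival routed to an idle server (None) or to a server of class k;
   if that server already holds b jobs the job is discarded *)
Definition arr {N b M : nat} (x : state N b M) (o : option ('I_b * 'I_M)) : state N b M :=
  match o with
  | None => match (insub 0%N : option 'I_b), (insub 0%N : option 'I_M) with
            | Some q0, Some m0 => incr x (q0, m0)
            | _, _ => x end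
  | Some (q, m) => match (insub q.+1 : option 'I_b) with
            | Some q' => incr (decr x (q, m)) (q', m)
            | None => x end
  end.

Definition adv {N b M : nat} (x : state N b M) (k : 'I_b * 'I_M) : state N b M :=
  match (insub k.2.+1 : option 'I_M) with
  | Some m' => incr (decr x k) (k.1, m')
  | None => x end.

(* departure of the job in service at a server of class k; the next job
   (if any) starts service in phase 1 *)
Definition dep {N b M : nat} (x : state N b M) (k : 'I_b * 'I_M) : state N b M :=
  if (k.1 : nat) == 0%N then decr x k else
  match (insub k.1.-1 : option 'I_b), (insub 0%N : option 'I_M) with
  | Some q', Some m0 => incr (decr x k) (q', m0)
  | _, _ => decr x k end.

Section Reals.
Context {R : realType}.

(* probability of entering the next phase after phase m (0-indexed) *)
Definition pe (M : nat) (p : nat -> R) (m : nat) : R :=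
  if (m.+1 < M)%N then p m else 0.

Definition dlt {T : eqType} (a c : T) : R := (a == c)%:R.

Definition lam (N : nat) (alpha : R) : R := 1 - (N%:R) `^ (- alpha).

Definition Qgen {N b M : nat} (alpha : R) (mu p : nat -> R)
  (route : state N b M -> option ('I_b * 'I_M) -> R) (x y : state N b M) : R :=
  lam N alpha * N%:R *
    \sum_(o : option ('I_b * 'I_M)) route x o * (dlt (arr x o) y - dlt x y)
  + \sum_(k : 'I_b * 'I_M) mu k.2 * (x k : nat)%:R *
      (pe M p k.2 * (dlt (adv x k) y - dlt x y)
       + (1 - pe M p k.2) * (dlt (dep x k) y - dlt x y)).

(* route x o : probability that a job arriving in state x is sent to an idle
   server (o = None) or to a server of class k (o = Some k) *)
Definition routing {N b M : nat} (route : state N b M -> option ('I_b * 'I_M) -> R) :=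
  forall x, valid x ->
    (forall o, 0 <= route x o) /\ \sum_o route x o = 1 /\
    (0 < route x None -> (busy x < N)%N) /\
    (forall k, 0 < route x (Some k) -> (0 < x k)%N).

Definition irreducible {N b M : nat} (alpha : R) (mu p : nat -> R)
  (route : state N b M -> option ('I_b * 'I_M) -> R) :=
  forall x y : state N b M, valid x -> valid y ->
    connect (fun a c => (a != c) && (0 < Qgen alpha mu p route a c)) x y.

Definition stationary {N b M : nat} (alpha : R) (mu p : nat -> R)
  (route : state N b M -> option ('I_b * 'I_M) -> R) (pi : state N b M -> R) :=
  (forall x, 0 <= pi x) /\ (forall x, ~~ valid x -> pi x = 0) /\
  \sum_x pi x = 1 /\ (forall y, \sum_x pi x * Qgen alpha mu p route x y = 0).

Definition Prob {N b M : nat} (pi : state N b M -> R) (E : pred (state N b M)) : R :=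
  \sum_(x | E x) pi x.

(* S_{i,m}: fraction of servers with at least i jobs whose job in service is
   in phase m+1 (i is 1-indexed as in the paper, m is 0-indexed) *)
Definition Sim {N b M : nat} (x : state N b M) (i : nat) (m : 'I_M) : R :=
  (\sum_(q < b | (i <= q.+1)%N) (x (q, m) : nat)%:R) / N%:R.

Definition s1 {N b M : nat} (x : state N b M) : R := \sum_(m < M) Sim x 1 m.

Definition A1 {N b M : nat} (route : state N b M -> option ('I_b * 'I_M) -> R)
  (x : state N b M) : R := \sum_k route x (Some k).

Definition LBzero {N b M : nat} (alpha : R)
  (route : state N b M -> option ('I_b * 'I_M) -> R) :=
  forall x, valid x ->
    s1 x <= 1 - ((N%:R) `^ alpha * ln (N%:R))^-1 ->
    A1 route x <= (Num.sqrt (N%:R))^-1.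

(* Constants; all indices 0-based: index m here is phase m+1 of the paper. *)
Definition v (mu p : nat -> R) (m : nat) : R := (\prod_(0 <= i < m) p i) / mu m.

Definition vbar (M : nat) (mu p : nat -> R) : R := \big[Num.min/1]_(m < M) v mu p m.

Definition a_ (mu p : nat -> R) (m : nat) : R := mu m / (p 0%N * mu 0%N + mu m).

Definition b_ (M : nat) (mu p : nat -> R) (m : nat) : R :=
  (1 - a_ mu p m) * (1 + \sum_(m.+1 <= r < M) v mu p r / v mu p 0%N)
  - a_ mu p m * v mu p m / v mu p 0%N.

Definition c_ (M : nat) (mu p : nat -> R) (m : nat) : R :=
  5 * (1 - a_ mu p m) * (\sum_(m.+1 <= r < M) r%:R * v mu p r)
  + 5 * a_ mu p m * (\sum_(1 <= r < m) mu r * v mu p r / mu m)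
  + 5 * (m%:R - 1) * a_ mu p m * v mu p m + 5 - a_ mu p m.

Definition xi (M : nat) (mu p : nat -> R) : R :=
  \sum_(1 <= m < M) b_ M mu p m * \prod_(m.+1 <= j < M) a_ mu p j.

Definition CM (M : nat) (mu p : nat -> R) : R :=
  \sum_(1 <= m < M) c_ M mu p m * \prod_(m.+1 <= j < M) a_ mu p j.

Definition Cc (M : nat) (mu p : nat -> R) : R :=
  Num.sqrt (2 * vbar M mu p ^+ 2 * ln (xi M mu p)^-1 /
            (3 * M%:R + (3 * M%:R + 4) * ln (xi M mu p)^-1)).

Definition theta (M : nat) (mu p : nat -> R) (m : nat) : R :=
  (6 * mu 0%N * v mu p m + 5 * m%:R * v mu p m) / Cc M mu p.

End Reals.

(* Main.v *)
Require Import Defs.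
From HB Require Import structures.
From mathcomp Require Import all_boot all_order all_algebra.
From mathcomp Require Import all_classical all_reals all_analysis.
From mathcomp Require Import zify ring lra.
Set Implicit Arguments. Unset Strict Implicit. Unset Printing Implicit Defensive.
Import Order.TTheory GRing.Theory Num.Theory.
Local Open Scope ring_scope.

(* One Lyapunov function replaces the iterated state-space peeling of the paper.
   Put eps = log N / (C sqrt N), nu = 1 - lam and let v be the equilibrium.
   The "facets" of the state are the scaled deficits of the phases
   [lowgap m] = lam - S_{1,m} / v_m - 5 m eps and the scaled excesses [upgap m] of
   S_{1,2} + ... + S_{1,m+1} over its equilibrium value.  If t is the largest
   facet, then t >= 4 mu_1 eps forces every facet within eps of t to drift
   downwards at a relative speed of at least eps / 2: a deficit in phase m + 1 is
   refilled from phase m, whose deficit is at most t; an excess is limited by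
   s_1 <= 1 and by the deficits of the other phases; and when the deficit of the
   first phase is near t, the bound on the last excess keeps s_1 below the LB-zero
   threshold, so that almost all arrivals enter the first phase.  Stationarity
   applied to the exponential of eta * facet, summed over all facets, bounds the
   probability that t exceeds 6 mu_1 eps by exp (- eta eps) <= N^-3.  The lower
   bounds on the S_{1,m} hold off that event and imply the upper bounds, because
   the S_{1,m} sum to at most 1. *)

(** * The generator on exponentials of phase counts *)

Section Counts.
Context {N b M : nat}.
Implicit Types (x : state N b M) (k : 'I_b * 'I_M) (m : 'I_M).

Definition cnt x m : nat := (\sum_(q < b) x (q, m))%N.

Lemma busyE x : busy x = (\sum_(m < M) cnt x m)%N.
Proof.
rewrite /busy /cnt exchange_big pair_big /=.
by apply: eq_bigr => -[q m].
Qed.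

(** Written without subtraction, so that one identity covers growth and decrease of the count in
    natural numbers. *)
Lemma sum_upd_col (x y : state N b M) k m :
  (forall k', k' != k -> y k' = x k') -> (k.2 == m)%N ->
  (cnt y m + x k = cnt x m + y k)%N.
Proof.
case: k => q m' /= H /eqP <-; rewrite /cnt (bigD1 q) //= [in RHS](bigD1 q) //=.
rewrite (eq_bigr (fun i => (x (i, m') : nat))) => [|i iq]; first by rewrite addnAC [RHS]addnAC (addnC (y _ : nat)).
by rewrite H // xpair_eqE negb_and iq.
Qed.

Lemma cnt_upd_other (x y : state N b M) k m :
  (forall k', k' != k -> y k' = x k') -> (m != k.2)%N -> cnt y m = cnt x m.
Proof.
move=> H mk; apply: eq_bigr => q _; rewrite H //.
by apply: contraNneq mk => <-.
Qed.

Lemma cnt_incr x k m : (x k < N)%N -> cnt (incr x k) m = (cnt x m + (m == k.2))%N.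
Proof.
move=> xk.
have E k' : k' != k -> incr x k k' = x k' by rewrite ffunE => /negbTE ->.
have [/eqP mk|mk] := boolP (m == k.2); last by rewrite (cnt_upd_other E mk) addn0.
have := sum_upd_col (m := m) E; rewrite mk eqxx => /(_ isT).
by rewrite ffunE eqxx inordK ?ltnS //=; lia.
Qed.

Lemma cnt_decr x k m : (0 < x k)%N -> (cnt (decr x k) m + (m == k.2) = cnt x m)%N.
Proof.
move=> xk.
have E k' : k' != k -> decr x k k' = x k' by rewrite ffunE => /negbTE ->.
have [/eqP mk|mk] := boolP (m == k.2); last by rewrite (cnt_upd_other E mk) addn0.
have := sum_upd_col (m := m) E; rewrite mk eqxx => /(_ isT).
rewrite ffunE eqxx inordK; first by lia.
by apply: leq_ltn_trans (ltn_ord (x k)); rewrite leq_pred.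
Qed.

Lemma le_busy x k : (x k <= busy x)%N.
Proof. by rewrite /busy (bigD1 k) //= leq_addr. Qed.

Lemma busy_decr x k : (0 < x k)%N -> ((busy (decr x k)).+1 = busy x)%N.
Proof.
move=> xk; rewrite !busyE -(eq_bigr _ (fun m _ => cnt_decr m xk)) big_split /=.
by rewrite -big_mkcond /= big_pred1_eq addn1.
Qed.

(** After [decr] fewer than [N] servers are busy, so the increment stays within ['I_N.+1] and
    [inord] does not fall back on its default. *)
Lemma cnt_move x k k' m : valid x -> (0 < x k)%N ->
  (cnt (incr (decr x k) k') m + (m == k.2) = cnt x m + (m == k'.2))%N.
Proof.
move=> vx xk; rewrite cnt_incr.
  by rewrite addnAC (cnt_decr _ xk).
have := le_busy (decr x k) k'; have := busy_decr xk; move: vx; rewrite /valid.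
lia.
Qed.

Lemma cnt_arr_idle x m : (0 < b)%N -> (busy x < N)%N ->
  cnt (arr x None) m = (cnt x m + (m == 0%N :> nat))%N.
Proof.
move=> b0 bx; rewrite /arr.
case: insubP => [q0 _ _|]; last by rewrite b0.
case: insubP => [m0 _ em|]; last by rewrite (leq_ltn_trans _ (ltn_ord m)).
rewrite cnt_incr /=; last exact: leq_ltn_trans (le_busy _ _) bx.
by rewrite -em.
Qed.

(** Joining a queue changes its length but not the phase in service, and a discarded job changes
    nothing. *)
Lemma cnt_arr_busy x k m : valid x -> (0 < x k)%N ->
  cnt (arr x (Some k)) m = cnt x m.
Proof.
case: k => q m' vx xk /=.
case: insubP => [q' _ _|//]; have /= := cnt_move (q', m') m vx xk; lia.
Qed.

Lemma cnt_adv x k m : valid x -> (0 < x k)%N -> (k.2.+1 < M)%N ->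
  (cnt (adv x k) m + (m == k.2 :> nat) = cnt x m + (m == k.2.+1 :> nat))%N.
Proof.
move=> vx xk kM; rewrite /adv.
case: insubP => [m' _ em|]; last by rewrite kM.
by have /= := cnt_move (k.1, m') m vx xk; rewrite -em.
Qed.

Lemma cnt_dep x k m : valid x -> (0 < x k)%N ->
  (cnt (dep x k) m + (m == k.2 :> nat) =
   cnt x m + ((k.1 != 0%N :> nat) && (m == 0%N :> nat)))%N.
Proof.
move=> vx xk; rewrite /dep; case: eqP => /= [_|_].
  by rewrite addn0; exact: cnt_decr.
case: insubP => [q' _ _|]; last first.
  by rewrite (leq_ltn_trans (leq_pred _) (ltn_ord _)).
case: insubP => [m0 _ em|]; last by rewrite (leq_ltn_trans _ (ltn_ord m)).
by have /= := cnt_move (q', m0) m vx xk; rewrite -em.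
Qed.

End Counts.

(** * Action of the generator on functions, and stationarity *)

Section Generator.
Context {R : realType} {N b M : nat}.
Implicit Types (x : state N b M) (k : 'I_b * 'I_M) (m : 'I_M).

Definition Gen (alpha : R) (mu p : nat -> R)
    (route : state N b M -> option ('I_b * 'I_M) -> R) (f : state N b M -> R) x : R :=
  lam N alpha * N%:R * \sum_(o : option ('I_b * 'I_M)) route x o * (f (arr x o) - f x)
  + \sum_(k : 'I_b * 'I_M) mu k.2 * (x k : nat)%:R *
      (pe M p k.2 * (f (adv x k) - f x) + (1 - pe M p k.2) * (f (dep x k) - f x)).

Lemma sum_dlt (f : state N b M -> R) a c :
  \sum_y (dlt a y - dlt c y) * f y = f a - f c.
Proof.
have D z : \sum_y dlt z y * f y = f z.
  rewrite (bigD1 z) //= /dlt eqxx mul1r big1 ?addr0 // => y.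
  by rewrite eq_sym => /negbTE ->; rewrite mul0r.
by under eq_bigr do rewrite mulrBl; rewrite big_split /= sumrN !D.
Qed.

Lemma Gen_Qgen alpha mu p route (f : state N b M -> R) x :
  \sum_y Qgen alpha mu p route x y * f y = Gen alpha mu p route f x.
Proof.
rewrite /Qgen /Gen; under eq_bigr do rewrite mulrDl.
rewrite big_split /=; congr (_ + _).
  under eq_bigr do rewrite -mulrA mulr_suml.
  rewrite -mulr_sumr exchange_big /=; congr (_ * _); apply: eq_bigr => o _.
  by under eq_bigr do rewrite -mulrA; rewrite -mulr_sumr sum_dlt.
under eq_bigr do rewrite mulr_suml.
rewrite exchange_big /=; apply: eq_bigr => k _.
under eq_bigr do rewrite -mulrA mulrDl -!(mulrA (pe _ _ _)) -!(mulrA (1 - _)).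
by rewrite -mulr_sumr big_split /= -!mulr_sumr !sum_dlt.
Qed.

Lemma stationary_Gen alpha mu p route (pi f : state N b M -> R) :
  stationary alpha mu p route pi ->
  \sum_x pi x * Gen alpha mu p route f x = 0.
Proof.
move=> [_ [_ [_ H]]]; under eq_bigr do rewrite -Gen_Qgen mulr_sumr.
rewrite exchange_big big1 //= => y _.
by under eq_bigr do rewrite mulrA; rewrite -mulr_suml H mul0r.
Qed.

Lemma sum_Some (route : state N b M -> option ('I_b * 'I_M) -> R) x :
  \sum_(o | o != None) route x o = A1 route x.
Proof.
rewrite (reindex_omap Some id) /=; last by case.
by apply: eq_bigl => k; rewrite eqxx.
Qed.

(** Each transition multiplies such a function by a factor that depends only on the change of the
    phase counts, so its generator is explicit. The exponentials of both kinds of facets have this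
    form. *)
Definition lexp (c : R) (d : nat -> R) x : R :=
  expR (c + \sum_(m < M) d m * (cnt x m)%:R).

Lemma lexp_shift c (d : nat -> R) x y (i o : R) :
  \sum_(m < M) d m * (cnt y m)%:R + o = \sum_(m < M) d m * (cnt x m)%:R + i ->
  lexp c d y = lexp c d x * expR (i - o).
Proof. by move=> H; rewrite /lexp -expRD; congr expR; lra. Qed.

Lemma sum_ord_pick (d : nat -> R) n (nM : (n < M)%N) :
  \sum_(m < M) d m * ((m : nat) == n)%:R = d n.
Proof.
rewrite (bigD1 (Ordinal nM)) //= eqxx mulr1 big1 ?addr0 // => i /eqP ni.
by case: eqP => [/= e|]; rewrite ?mulr0 //; case: ni; apply: val_inj.
Qed.

(* Departures from a queue restart in the first phase; since [d 0 <= 0] this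
   refill only decreases the exponential, so it can be discarded. *)
Lemma Gen_lexp_le (alpha : R) (mu p : nat -> R) route (c : R) (d : nat -> R) (x : state N b M) :
  (0 < b)%N -> (0 < M)%N -> routing route -> valid x ->
  (forall m, 0 < mu m) -> (forall m, 0 <= pe M p m <= 1) -> d 0%N <= 0 ->
  Gen alpha mu p route (lexp c d) x <=
  lexp c d x * (lam N alpha * N%:R * (1 - A1 route x) * (expR (d 0%N) - 1)
   + \sum_(m < M) mu m * (cnt x m)%:R *
      (pe M p m * (expR (d m.+1 - d m) - 1) + (1 - pe M p m) * (expR (- d m) - 1))).
Proof.
move=> b0 M0 rt vx mu0 p01 d0.
have [r0 [r1 [rN rS]]] := rt x vx.
have e0 : 0 < lexp c d x by rewrite expR_gt0.
rewrite /Gen mulrDr; apply: lerD.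
  rewrite le_eqVlt; apply/orP; left; apply/eqP.
  (* Only [None] contributes: a job sent to a busy server leaves the phase counts unchanged. *)
  have -> : \sum_o route x o * (lexp c d (arr x o) - lexp c d x) =
     route x None * (lexp c d x * expR (d 0%N) - lexp c d x).
    rewrite (bigD1 None) //= big1 ?addr0 => [|[k|//] _]; last first.
      have [->|rk] := eqVneq (route x (Some k)) 0; first by rewrite mul0r.
      have xk : (0 < x k)%N by apply: rS; rewrite lt0r rk r0.
      have -> : lexp c d (arr x (Some k)) = lexp c d x.
        rewrite /lexp; congr (expR (_ + _)); apply: eq_bigr => m _.
        by rewrite cnt_arr_busy.
      by rewrite subrr mulr0.
    have [->|rk] := eqVneq (route x None) 0; first by rewrite !mul0r.
    have xk : (busy x < N)%N by apply: rN; rewrite lt0r rk r0.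
    rewrite (@lexp_shift _ _ x _ (d 0%N) (0)) ?subr0 //.
    rewrite addr0 -[in RHS](sum_ord_pick d M0) -big_split /=; apply: eq_bigr => m _.
    by rewrite cnt_arr_idle // natrD mulrDr.
  have -> : 1 - A1 route x = route x None.
    by rewrite -r1 (bigD1 None) //= sum_Some addrK.
  by ring.
rewrite mulr_sumr; under [leRHS]eq_bigr => m _ do
  rewrite /cnt natr_sum mulr_sumr mulr_suml mulr_sumr.
rewrite exchange_big pair_big /=; apply: ler_sum => -[q m] _ /=.
have [->|xk] := posnP (x (q, m)); first by rewrite !mulr0 !mul0r mulr0.
have -> : forall A B C D : R, A * (B * C * D) = B * C * (A * D) by move=> *; ring.
apply: ler_wpM2l; first by rewrite mulr_ge0 // ltW.
have /andP[p0 p1] := p01 m.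
rewrite [leRHS]mulrDr; apply: lerD.
  rewrite mulrCA /pe; case: ifP => mM; last by rewrite !mul0r.
  rewrite (@lexp_shift _ _ x _ (d m.+1) (d m)).
    by rewrite -{2}[lexp c d x]mulr1 -mulrBr.
  rewrite -[d m.+1](sum_ord_pick d mM) -[d m](sum_ord_pick d (ltn_ord m)).
  rewrite -!big_split /=; apply: eq_bigr => m' _.
  by rewrite -!mulrDr -!natrD (cnt_adv m' vx xk mM).
rewrite mulrCA; apply: ler_wpM2l; first by rewrite subr_ge0.
rewrite (@lexp_shift _ _ x _ ((q != 0%N :> nat)%:R * d 0%N) (d m)).
  rewrite -{2}[lexp c d x]mulr1 -mulrBr ler_wpM2l ?(ltW e0) // lerD2r ler_expR.
  by case: (_ != _); rewrite ?mul1r ?mul0r; lra.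
rewrite -[d 0%N](sum_ord_pick d M0) -[d m](sum_ord_pick d (ltn_ord m)).
rewrite mulr_sumr -!big_split /=; apply: eq_bigr => m' _.
rewrite mulrCA -!mulrDr -natrM mulnb -!natrD; congr (_ * _%:R).
exact: (cnt_dep m' vx xk).
Qed.

End Generator.

(** * Facets and their drift *)

(** From [1 - h <= expR (- h)] follows [expR h <= (1 - h)^-1], and [(1 - h) * (1 + 2 * h) >= 1] for
    [h] in this range. *)
Lemma expRB1_le {R : realType} (h : R) : 0 <= h <= 2^-1 ->
  expR h - 1 <= h * (1 + 2 * h).
Proof.
move=> /andP[h0 h1]; have := expR_ge1Dx (- h); rewrite expRN => H.
have e0 := expR_gt0 h.
have : expR h * (1 - h) <= 1 by rewrite -ler_pdivlMl ?mulr1 // mulrC.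
by nra.
Qed.

Lemma expRNB1_le {R : realType} (h : R) : 0 <= h ->
  expR (- h) - 1 <= - (h * (1 - h)).
Proof.
move=> h0; have := expR_ge1Dx h; rewrite -[expR h]invrK -expRN => H.
have e0 := expR_gt0 (- h).
have : (1 + h) * expR (- h) <= 1 by rewrite -ler_pdivlMr // div1r.
by nra.
Qed.

(** * Linear recursions of first order *)

Section Recursion.
Context {R : realType}.

(** [xi] and [CM] are values of this recursion at [M.-1] with coefficients [a_]; in this form their
    sums of products become balances from one phase to the next. *)
Fixpoint linrec (a e : nat -> R) (m : nat) : R :=
  if m is k.+1 then a m * linrec a e k + e m else 0.

Lemma linrecE (a e : nat -> R) m :
  linrec a e m = \sum_(1 <= r < m.+1) e r * \prod_(r.+1 <= j < m.+1) a j.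
Proof.
elim: m => [|m IH]; first by rewrite big_geq.
rewrite big_nat_recr //= [\prod_(m.+2 <= j < m.+2) _]big_geq // mulr1 IH; congr (_ + _).
rewrite mulr_sumr; apply: eq_big_nat => r /andP[_ rm].
by rewrite [in RHS]big_nat_recr //=; ring.
Qed.

(** With input [1 - a m] each step multiplies the distance of the value from 1 by [a m]. *)
Lemma linrec1B (a : nat -> R) m :
  linrec a (fun r => 1 - a r) m = 1 - \prod_(1 <= j < m.+1) a j.
Proof.
elim: m => [|m IH]; first by rewrite big_geq ?subrr.
by rewrite big_nat_recr //= IH; ring.
Qed.

Lemma linrecD (a e f : nat -> R) (c d : R) m :
  linrec a (fun r => e r * c + d * f r) m = linrec a e m * c + d * linrec a f m.
Proof. by elim: m => [|m IH] /=; rewrite ?IH; ring. Qed.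

End Recursion.

(** The linear core of [updown_near], each sum being replaced by a variable. The cap on the total
    bounds [x0] from above, the comparison of two consecutive excesses bounds [x'] from below, and
    [q * v0 = p0] cancels all terms in [t]. The equation for [o'] then leaves the stated margin. *)
Lemma updown_arith {R : realType}
    (eps nu t p0 q mu' m o o' x0 Xs x' Tx v0 Sv v' Tv w K J D : R) :
  0 <= eps -> 0 <= q -> 0 < mu' -> 0 <= eps * (m * (mu' * v')) -> q * v0 = p0 ->
  w <= 1 -> w = v0 + Tv ->
  (q + mu') * o' = mu' * o + q * nu
     + eps * (5 * q * K + 5 * J + 5 * m * (mu' * v') + 4 * (q + mu') - mu') ->
  x0 + (Xs + (x' + Tx)) <= 1 -> v0 + (Sv + (v' + Tv)) = 1 ->
  (1 - nu - t) * Tv - 5 * eps * K <= Tx ->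
  (1 - nu - t) * (p0 - mu' * v') - 5 * eps * (J - m * (mu' * v')) <= D ->
  Xs <= t * (w + v') + (1 - nu) * Sv + o ->
  (t - eps) * w + (1 - nu) * (Sv + v') + o' <= Xs + x' ->
  q * x0 - (D + mu' * x') <= - (2 * eps * (q + mu')).
Proof.
move=> eps0 q0 m1 Hm Hq w1 Hw Ho xs vs HT HD H1 H2.
have E : (1 - nu) * Sv = (1 - nu) * (1 - v0 - v' - Tv) by congr (_ * _); lra.
have X0 : x0 <= nu + (1 - nu - t) * v0 - o' + eps * w + 5 * eps * K.
  by rewrite Hw in H2 *; move: E; lra.
have X1 : (1 - nu - t) * v' + o' - o - eps * w <= x' by lra.
have P0 := ler_wpM2l q0 X0; have P1 := ler_wpM2l (ltW m1) X1.
have E0 : 0 <= q * (eps * (1 - w)) by rewrite !mulr_ge0 // subr_ge0.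
have E1 : 0 <= mu' * (eps * (1 - w)) by rewrite !mulr_ge0 ?(ltW m1) // subr_ge0.
have E2 : 0 <= q * eps by rewrite mulr_ge0.
have E3 : 0 <= mu' * eps by rewrite mulr_ge0 // ltW.
clear Hw w1 xs HT H1 H2 X0 X1 E vs.
rewrite -Hq in HD; lra.
Qed.

(** * Deterministic drift inequalities near the largest facet *)

Section Facets.
Context {R : realType} (M : nat) (mu p : nat -> R) (nu eps : R) (x : nat -> R).
Local Notation v := (v mu p).
Local Notation a := (a_ mu p).
Local Notation c := (c_ M mu p).

(** Equilibrium mass outside the block of phases 2 to m + 1. If every phase outside lacks the
    fraction [t] of its mass, the block can gain [t * wt m]; dividing excesses by [wt m] puts them
    on the scale of the deficits. *)
Definition wt (m : nat) : R := v 0 + \sum_(m.+1 <= r < M) v r.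

(* The recursion solved by [off] is the balance of phases 2 to m, with
   total rate [p_1 mu_1 + mu_m]; the [- 1] next to [c r] is the share of the margin
   of [CM] that is kept for the first phase. *)
Definition off (m : nat) : R :=
  linrec a (fun r => (1 - a r) * nu + eps * (c r - 1)) m.

(** The offset separates consecutive phases: if [lowgap m <= t] and [t - eps <= lowgap m.+1], then
    [x m.+1 / v m.+1] lies at least [4 * eps] below [x m / v m]. *)
Definition lowgap (m : nat) : R := 1 - nu - x m / v m - 5 * m%:R * eps.

Definition upgap (m : nat) : R :=
  (\sum_(1 <= r < m.+1) x r - (1 - nu) * (\sum_(1 <= r < m.+1) v r) - off m) / wt m.

Hypothesis mu_gt0 : forall m, (m < M)%N -> 0 < mu m.
Hypothesis v_gt0 : forall m, (m < M)%N -> 0 < v m.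
Hypothesis p01 : forall m, (m.+1 < M)%N -> 0 <= p m < 1.
Hypothesis v_sum : \sum_(0 <= m < M) v m = 1.
Hypothesis x_sum : \sum_(0 <= m < M) x m <= 1.
Hypothesis eps_ge0 : 0 <= eps.

Lemma v0mu0 : (0 < M)%N -> v 0 * mu 0 = 1.
Proof. by move=> M0; rewrite /v big_geq // mul1r mulVf // gt_eqF ?mu_gt0. Qed.

Lemma v_rec m : (m.+1 < M)%N -> mu m.+1 * v m.+1 = p m * mu m * v m.
Proof.
move=> mM; rewrite /v big_nat_recr //=.
have := mu_gt0 mM; have := mu_gt0 (ltnW mM) => h1 h2.
by field; rewrite !gt_eqF.
Qed.

Lemma wt_gt0 m : (0 < M)%N -> 0 < wt m.
Proof.
move=> M0; rewrite /wt ltr_wpDr ?v_gt0 //; rewrite big_nat_cond.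
by apply: sumr_ge0 => i /andP[/andP[_ iM] _]; rewrite ltW ?v_gt0.
Qed.

Lemma wt_le1 m : (0 < M)%N -> wt m <= 1.
Proof.
move=> M0; rewrite -v_sum big_ltn // lerD2l.
have [mM|Mm] := ltnP m M; last first.
  rewrite [leLHS]big_geq ?(leqW Mm) // big_nat_cond sumr_ge0 // => i /andP[/andP[_ iM] _].
  by rewrite ltW ?v_gt0.
rewrite [leRHS](big_cat_nat (n := m.+1)) //= lerDr.
rewrite big_nat_cond sumr_ge0 // => i /andP[/andP[_ iM] _].
by rewrite ltW ?v_gt0 // (leq_trans iM).
Qed.

Lemma wtS m : (m.+1 < M)%N -> wt m = wt m.+1 + v m.+1.
Proof. by move=> mM; rewrite /wt big_ltn //; ring. Qed.

(** At equilibrium the flow [p 0] into phase 2 splits into departures and the flow that reaches the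
    phase of index [m.+1]; the sum telescopes by [v_rec]. *)
Lemma sum_dep_v m : (m.+1 < M)%N ->
  \sum_(1 <= r < m.+1) (1 - p r) * mu r * v r = p 0%N - mu m.+1 * v m.+1.
Proof.
elim: m => [|m IH] mM.
  by rewrite big_geq // v_rec // -mulrA [mu 0 * _]mulrC v0mu0 ?mulr1 ?subrr // ltnW.
by rewrite big_nat_recr //= IH ?(ltnW mM) // [mu m.+2 * _]v_rec //; ring.
Qed.

(** The weights [r%:R] come from the offsets in [lowgap]; this is a summation by parts. *)
Lemma sum_dep_vr m : (m.+1 < M)%N ->
  \sum_(1 <= r < m.+1) (1 - p r) * mu r * v r * r%:R =
  \sum_(1 <= r < m.+1) mu r * v r - m%:R * (mu m.+1 * v m.+1).
Proof.
elim: m => [|m IH] mM; first by rewrite !big_geq // mul0r subrr.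
rewrite big_nat_recr //= [\sum_(1 <= i < m.+2) (mu i * _)]big_nat_recr //=.
rewrite IH ?(ltnW mM) // [mu m.+2 * _]v_rec //.
by rewrite -natr1; ring.
Qed.

Lemma lowgapE m t : (m < M)%N -> lowgap m <= t ->
  v m * (1 - nu - t - 5 * m%:R * eps) <= x m.
Proof.
move=> mM; rewrite /lowgap => H.
rewrite mulrC -ler_pdivlMr ?v_gt0 //; lra.
Qed.

Lemma upgap_le m t : (0 < M)%N -> (upgap m <= t) =
  (\sum_(1 <= r < m.+1) x r <=
   t * wt m + (1 - nu) * (\sum_(1 <= r < m.+1) v r) + off m).
Proof.
by move=> M0; rewrite /upgap ler_pdivrMr ?wt_gt0 // !lerBlDr addrAC.
Qed.

Lemma le_upgap m t : (0 < M)%N -> (t <= upgap m) =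
  (t * wt m + (1 - nu) * (\sum_(1 <= r < m.+1) v r) + off m <=
   \sum_(1 <= r < m.+1) x r).
Proof.
by move=> M0; rewrite /upgap ler_pdivlMr ?wt_gt0 // !lerBrDr addrAC.
Qed.

(** For positive [m], the net flow into phases 2 to m + 1. Phase m + 1 counts with its full rate,
    because a job completing it leaves the block whether it departs or moves on. *)
Definition updown m : R := p 0%N * mu 0%N * x 0%N -
  (\sum_(1 <= r < m) (1 - p r) * mu r * x r + mu m * x m).

Definition gtot m : R := p 0%N * mu 0%N + mu m.

Lemma off_rec m : (m.+1 < M)%N ->
  gtot m.+1 * off m.+1 = mu m.+1 * off m + p 0%N * mu 0%N * nu
   + eps * (5 * (p 0%N * mu 0%N) * (\sum_(m.+2 <= r < M) r%:R * v r)
            + 5 * (\sum_(1 <= r < m.+1) mu r * v r)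
            + 5 * m%:R * (mu m.+1 * v m.+1) + 4 * gtot m.+1 - mu m.+1).
Proof.
move=> mM; rewrite /off /= -/(off m) /c_ /a_ -mulr_suml -/(gtot m.+1).
have m1 := mu_gt0 mM.
have m0 := mu_gt0 (ltn_trans (ltn0Sn m) mM).
have /andP[p0 _] := p01 (leq_ltn_trans (ltn0Sn m : (1 <= m.+1)%N) mM).
have g0 : gtot m.+1 != 0 by rewrite /gtot gt_eqF // ltr_wpDl // mulr_ge0 // ltW.
have -> : p 0%N * mu 0%N = gtot m.+1 - mu m.+1 by rewrite /gtot; ring.
rewrite -[m.+1%:R]natr1; move: (gtot _) g0 => g g0.
set K := \sum_(m.+2 <= r < M) _; set J := \sum_(1 <= r < m.+1) _.
move: (off m) K J => o K J; field.
by rewrite g0 gt_eqF.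
Qed.

(** Deficits of at most [t] bound from below the occupancy of the later phases ([T]) and the
    departures from the earlier phases of the block ([D]); [updown_arith] does the rest. *)
Lemma updown_near m t : (m.+1 < M)%N ->
  (forall r, (r < M)%N -> lowgap r <= t) -> upgap m <= t ->
  t - eps <= upgap m.+1 -> updown m.+1 <= - (2 * eps * gtot m.+1).
Proof.
move=> mM Hl Hu Hn.
have M0 : (0 < M)%N by lia.
move: Hu Hn; rewrite upgap_le // le_upgap //.
rewrite [\sum_(1 <= r < m.+2) x r]big_nat_recr //= [\sum_(1 <= r < m.+2) v r]big_nat_recr //=.
have Hwt := wtS mM; have Hw1 := wt_le1 m.+1 M0; have Hw0 := wt_gt0 m.+1 M0.
have Hoff := off_rec mM.
have xs : x 0%N + (\sum_(1 <= r < m.+1) x r + (x m.+1 + \sum_(m.+2 <= r < M) x r)) <= 1.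
  rewrite -[\sum_(m.+2 <= r < M) x r](add0r _) add0r -big_ltn //.
  by rewrite -big_cat_nat //=; [rewrite -big_ltn | exact: ltnW].
have vs : v 0%N + (\sum_(1 <= r < m.+1) v r + (v m.+1 + \sum_(m.+2 <= r < M) v r)) = 1.
  rewrite -big_ltn // -big_cat_nat //=; last exact: ltnW.
  by rewrite -big_ltn.
have T : (1 - nu - t) * (\sum_(m.+2 <= r < M) v r)
   - 5 * eps * (\sum_(m.+2 <= r < M) r%:R * v r) <= \sum_(m.+2 <= r < M) x r.
  rewrite !mulr_sumr -sumrB; apply: ler_sum_nat => r /andP[_ rM].
  apply: le_trans (lowgapE rM (Hl _ rM)).
  by rewrite le_eqVlt; apply/orP; left; apply/eqP; ring.
have D : (1 - nu - t) * (p 0%N - mu m.+1 * v m.+1) - 5 * eps *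
    (\sum_(1 <= r < m.+1) mu r * v r - m%:R * (mu m.+1 * v m.+1))
    <= \sum_(1 <= r < m.+1) (1 - p r) * mu r * x r.
  rewrite -sum_dep_v // -sum_dep_vr // !mulr_sumr -sumrB.
  apply: ler_sum_nat => r /andP[_ rM].
  have rM' : (r < M)%N by lia.
  have /andP[_ p1] := p01 (leq_ltn_trans rM mM).
  have c0 : 0 <= (1 - p r) * mu r by rewrite mulr_ge0 ?ltW ?subr_gt0 ?mu_gt0.
  apply: le_trans (ler_wpM2l c0 (lowgapE rM' (Hl _ rM'))).
  by rewrite le_eqVlt; apply/orP; left; apply/eqP; ring.
have /andP[p0 _] : 0 <= p 0%N < 1 by apply: p01; lia.
have m0 : 0 < mu 0%N by apply: mu_gt0.
have m1 := mu_gt0 mM; have v1 := v_gt0 mM; have vm := v0mu0 M0.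
have q0 : 0 <= p 0%N * mu 0%N by rewrite mulr_ge0 // ltW.
have Hq : p 0%N * mu 0%N * v 0%N = p 0%N by rewrite -mulrA [mu 0%N * _]mulrC vm mulr1.
have Hm : 0 <= eps * (m%:R * (mu m.+1 * v m.+1)).
  by rewrite mulr_ge0 // mulr_ge0 // mulr_ge0 // ltW.
move=> H1 H2; rewrite Hwt in H1.
exact: (updown_arith eps_ge0 q0 m1 Hm Hq Hw1 (erefl _) Hoff xs vs T D H1 H2).
Qed.

(** For the last block [wt] reduces to [v 0], so the room [t * v 0] left to the excess is cancelled
    by the deficit of the first phase, up to [eps * v 0]. *)
Lemma x_sum_near t : (0 < M)%N -> upgap M.-1 <= t -> t - eps <= lowgap 0 ->
  \sum_(0 <= m < M) x m <= 1 - nu + eps * v 0%N + off M.-1.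
Proof.
move=> M0; rewrite upgap_le // prednK // /lowgap => Hu Hl.
have w0 : wt M.-1 = v 0%N by rewrite /wt prednK // big_geq // addr0.
have vs : v 0%N + \sum_(1 <= i < M) v i = 1 by rewrite -big_ltn.
rewrite big_ltn //.
have v0 := v_gt0 M0.
have X0 : x 0%N <= (1 - nu - t + eps) * v 0%N.
  by rewrite -ler_pdivrMr //; lra.
have : (1 - nu) * (v 0%N + \sum_(1 <= i < M) v i) = 1 - nu by rewrite vs mulr1.
by move: Hu; rewrite w0; lra.
Qed.

End Facets.

(** * Contribution of phase completions to the drift of a facet *)

Section PhaseSums.
Context {R : realType} (M : nat) (mu p X : nat -> R) (h : R).

Definition phase_rate (d : nat -> R) (j : nat) : R :=
  mu j * X j *
    (pe M p j * (expR (d j.+1 - d j) - 1) + (1 - pe M p j) * (expR (- d j) - 1)).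

(** [dlow] and [dup] are the slopes, in the phase counts, of the exponents of a deficit and of an
    excess. For [h >= 0] both meet the condition [d 0 <= 0] of [Gen_lexp_le]. *)
Definition dlow (m j : nat) : R := if j == m then - h else 0.
Definition dup (m j : nat) : R := if (0 < j <= m)%N then h else 0.

Lemma phase_low0 : (0 < M)%N ->
  \sum_(j < M) phase_rate (dlow 0) j = mu 0%N * X 0%N * (expR h - 1).
Proof.
move=> M0.
rewrite -(sum_ord_pick (fun j => mu j * X j * (expR h - 1)) M0).
apply: eq_bigr => j _; rewrite /phase_rate /dlow /=.
case: eqP => _; last by rewrite mulr0 subr0 oppr0 expR0; ring.
by rewrite mulr1 sub0r opprK; ring.
Qed.

Lemma phase_lowS m : (m.+1 < M)%N ->
  \sum_(j < M) phase_rate (dlow m.+1) j =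
  p m * (mu m * X m) * (expR (- h) - 1) + mu m.+1 * X m.+1 * (expR h - 1).
Proof.
move=> mM.
rewrite -(sum_ord_pick (fun j => p j * (mu j * X j) * (expR (- h) - 1)) (ltnW mM)).
rewrite -(sum_ord_pick (fun j => mu j * X j * (expR h - 1)) mM).
rewrite -big_split /=; apply: eq_bigr => j _; rewrite /phase_rate /dlow eqSS.
have [->|jm] := eqVneq (j : nat) m.
  by rewrite (ltn_eqF (ltnSn m)) mulr0 mulr1 subr0 oppr0 expR0 /pe mM; ring.
have [_|_] := eqVneq (j : nat) m.+1; last by rewrite !mulr0 subr0 oppr0 expR0; ring.
by rewrite mulr0 mulr1 sub0r opprK; ring.
Qed.

(** Moves inside the block leave the exponent unchanged, so only entries from the first phase and
    exits remain. *)
Lemma phase_up m : (m.+1 < M)%N ->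
  \sum_(j < M) phase_rate (dup m.+1) j =
  p 0%N * mu 0%N * X 0%N * (expR h - 1)
  + (\sum_(1 <= j < m.+1) (1 - p j) * mu j * X j + mu m.+1 * X m.+1) * (expR (- h) - 1).
Proof.
move=> mM.
have Z : \sum_(m.+2 <= j < M) phase_rate (dup m.+1) j = 0.
  rewrite big_nat_cond big1 // => j /andP[/andP[jm jM] _].
  rewrite /phase_rate /dup [(j <= _)%N]leqNgt jm andbF.
  by rewrite [(j.+1 <= _)%N]leqNgt (ltn_trans jm (ltnSn j)) /= subr0 oppr0 expR0; ring.
rewrite -(big_mkord xpredT) big_ltn; last by lia.
rewrite (big_cat_nat (n := m.+1)) //=; last exact: ltnW.
rewrite [X in _ + (_ + X)]big_ltn // Z addr0; congr (_ + _).
  rewrite /phase_rate /dup /pe /= subr0 oppr0 expR0 ifT; last by lia.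
  by ring.
rewrite mulrDl; congr (_ + _).
  rewrite mulr_suml; apply: eq_big_nat => j /andP[j1 jm].
  rewrite /phase_rate /dup /pe j1 (ltnW jm) /= jm subrr expR0.
  by rewrite (leq_ltn_trans jm mM); ring.
by rewrite /phase_rate /dup /= leqnn ltnn sub0r; ring.
Qed.

Lemma phase_up0 : \sum_(j < M) phase_rate (dup 0) j = 0.
Proof.
have E i : dup 0 i = 0 by rewrite /dup; case: i.
by apply: big1 => j _; rewrite /phase_rate !E subr0 oppr0 expR0; ring.
Qed.

End PhaseSums.

(** * Generator bounds for the facet exponentials *)

Section FacetGenerator.
Context {R : realType} {N b M : nat}.
Implicit Types (s : state N b M).

(** Extended by zero to all natural indices, so that occupancies and equilibrium values are summed
    over the same ranges. *)
Definition occ s (m : nat) : R :=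
  if insub m is Some i then Sim s 1 (i : 'I_M) else 0.

Lemma occE s (m : 'I_M) : occ s m = Sim s 1 m.
Proof. by rewrite /occ valK. Qed.

Lemma Sim_cnt s (m : 'I_M) : Sim s 1 m = (cnt s m)%:R / N%:R :> R.
Proof. by rewrite /Sim /cnt natr_sum. Qed.

Lemma occ_ge0 s m : 0 <= occ s m.
Proof. by rewrite /occ; case: insubP => // i _ _; rewrite Sim_cnt divr_ge0. Qed.

Lemma sum_occE s : \sum_(0 <= m < M) occ s m = s1 s.
Proof. by rewrite big_mkord; apply: eq_bigr => m _; rewrite occE. Qed.

Lemma sum_occ_le1 s : (0 < N)%N -> valid s -> \sum_(0 <= m < M) occ s m <= 1.
Proof.
move=> N0 vs; rewrite sum_occE /s1; under eq_bigr do rewrite Sim_cnt.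
by rewrite -mulr_suml -natr_sum -busyE ler_pdivrMr ?ltr0n // mul1r ler_nat.
Qed.

Context (alpha : R) (mu p : nat -> R) (route : state N b M -> option ('I_b * 'I_M) -> R).
Context (nu eps eta : R).
Local Notation v := (v mu p).
Local Notation lgap s := (lowgap mu p nu eps (occ s)).
Local Notation ugap s := (upgap M mu p nu eps (occ s)).

Hypothesis N_gt0 : (0 < N)%N.
Hypothesis b_gt0 : (0 < b)%N.
Hypothesis M_gt0 : (0 < M)%N.
Hypothesis mu_gt0 : forall m, (m < M)%N -> 0 < mu m.
Hypothesis v_gt0 : forall m, (m < M)%N -> 0 < v m.
Hypothesis p01 : forall m, (m.+1 < M)%N -> 0 <= p m < 1.
Hypothesis lam_ge0 : 0 <= lam N alpha.
Hypothesis rt : routing route.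
Hypothesis eta_gt0 : 0 < eta.

(** Size of the jump of [eta * lowgap] when one server enters or leaves phase [m]. *)
Definition step_low m : R := eta / (N%:R * v m).
Definition step_up m : R := eta / (N%:R * wt M mu p m).

(** Bound on the drift of the exponential relative to its value, in units of [mu m * eta]; the
    factors come from [expRB1_le] and [expRNB1_le]. The first phase is refilled by arrivals at idle
    servers, the others by the preceding phase. *)
Definition klow s m : R :=
  occ s m / v m * (1 + 2 * step_low m) -
  (if m is k.+1 then occ s k / v k else lam N alpha * (1 - A1 route s))
  * (1 - step_low m).

Definition kup s m : R := if m is 0 then 0 else
  (p 0%N * mu 0%N * occ s 0%N * (1 + 2 * step_up m) -
   (\sum_(1 <= j < m) (1 - p j) * mu j * occ s j + mu m * occ s m) * (1 - step_up m))
  / gtot mu p m.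

Let N0 : 0 < N%:R :> R. Proof. by rewrite ltr0n. Qed.

Lemma cnt_occ s (m : 'I_M) : (cnt s m)%:R = N%:R * occ s m.
Proof. by rewrite occE Sim_cnt mulrCA divff ?mulr1 // gt_eqF. Qed.

Lemma pe01 (m : 'I_M) : 0 <= pe M p m <= 1.
Proof. by rewrite /pe; case: ifP => [/p01/andP[-> /ltW ->//]|_]; rewrite lexx ler01. Qed.

Lemma lowgap_lexp s m : (m < M)%N ->
  expR (eta * lgap s m) =
  lexp (eta * (1 - nu - 5 * m%:R * eps)) (dlow (step_low m) m) s.
Proof.
move=> mM; rewrite /lexp /lowgap; congr expR.
have -> : \sum_(i < M) dlow (step_low m) m i * (cnt s i)%:R = - step_low m * (N%:R * occ s m).
  rewrite -(sum_ord_pick (fun j => - step_low m * (N%:R * occ s j)) mM).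
  apply: eq_bigr => i _; rewrite cnt_occ /dlow.
  by case: eqP => _; rewrite ?mulr1 ?mulr0 ?mul0r.
have vm := v_gt0 mM; rewrite /step_low; move: (v m) vm => w w0.
by field; rewrite !gt_eqF.
Qed.

Lemma upgap_lexp s m : (m < M)%N ->
  expR (eta * ugap s m) =
  lexp (- eta * ((1 - nu) * (\sum_(1 <= r < m.+1) v r) + off M mu p nu eps m) / wt M mu p m)
    (dup (step_up m) m) s.
Proof.
move=> mM; rewrite /lexp /upgap; congr expR.
have -> : \sum_(i < M) dup (step_up m) m i * (cnt s i)%:R =
    step_up m * (N%:R * \sum_(1 <= r < m.+1) occ s r).
  rewrite !mulr_sumr (big_nat_widen _ _ M) //= (big_nat_widenl _ 0) //=.
  rewrite big_mkord [RHS]big_mkcond /=.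
  apply: eq_bigr => i _; rewrite cnt_occ /dup ltnS /= [(i <= m)%N && _]andbC.
  by case: ifP; rewrite ?mul0r.
have wm := wt_gt0 v_gt0 m M_gt0; rewrite /step_up; move: (wt _ _ _ _) wm => w w0.
by field; rewrite !gt_eqF.
Qed.

Lemma Gen_low s m : valid s -> (m < M)%N -> 0 <= step_low m <= 2^-1 ->
  Gen alpha mu p route (fun s => expR (eta * lgap s m)) s <=
  mu m * eta * (expR (eta * lgap s m) * klow s m).
Proof.
move=> vs mM h01.
have -> : (fun s => expR (eta * lgap s m)) =
  lexp (eta * (1 - nu - 5 * m%:R * eps)) (dlow (step_low m) m).
  by apply/funext => s'; rewrite lowgap_lexp.
have h0 : 0 <= step_low m by case/andP: h01.
apply: le_trans (Gen_lexp_le _ _ b_gt0 M_gt0 rt vs _ pe01 _) _.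
- by move=> i; exact: mu_gt0.
- by rewrite /dlow; case: eqP => // _; rewrite oppr_le0.
rewrite lowgap_lexp // mulrCA; apply: ler_wpM2l; first exact: expR_ge0.
rewrite (eq_bigr (fun i : 'I_M => phase_rate M mu p (fun j => N%:R * occ s j)
  (dlow (step_low m) m) i)); last by move=> i _; rewrite cnt_occ.
have e1 := expRB1_le h01; have e2 := expRNB1_le h0.
have He : eta = step_low m * (N%:R * v m).
  by rewrite /step_low divfK // mulf_neq0 // gt_eqF ?v_gt0.
have vm := v_gt0 mM.
have A0 : 0 <= lam N alpha * N%:R * (1 - A1 route s).
  rewrite !mulr_ge0 //; have [r0 [r1 _]] := rt vs.
  by rewrite -r1 (bigD1 None) //= sum_Some addrK.
case: m mM h01 h0 e1 e2 He vm => [|m] mM h01 h0 e1 e2 He vm.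
  rewrite phase_low0 // /dlow /= /klow.
  have P1 := ler_wpM2l A0 e2.
  have P2 : mu 0%N * (N%:R * occ s 0%N) * (expR (step_low 0) - 1) <=
     mu 0%N * (N%:R * occ s 0%N) * (step_low 0 * (1 + 2 * step_low 0)).
    by apply: ler_wpM2l => //; rewrite !mulr_ge0 ?occ_ge0 // ltW // mu_gt0.
  apply: le_trans (lerD P1 P2) _; rewrite [in X in _ <= X]He.
  have v1 := v0mu0 p mu_gt0 M_gt0 : v 0%N * mu 0%N = 1.
  rewrite le_eqVlt; apply/orP; left; apply/eqP.
  have -> : v 0%N = (mu 0%N)^-1 by apply: (mulIf (lt0r_neq0 (mu_gt0 mM))); rewrite v1 mulVf ?gt_eqF ?mu_gt0.
  move: (step_low 0) => h; have := mu_gt0 mM => m0.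
  by field; rewrite gt_eqF.
rewrite phase_lowS // [dlow _ _ 0]/dlow /= expR0 subrr mulr0 add0r /klow.
have m0 := mu_gt0 mM; have mm := mu_gt0 (ltnW mM); have /andP[p0 _] := p01 mM.
have P1 : p m * (mu m * (N%:R * occ s m)) * (expR (- step_low m.+1) - 1) <=
   p m * (mu m * (N%:R * occ s m)) * - (step_low m.+1 * (1 - step_low m.+1)).
  by apply: ler_wpM2l => //; rewrite !mulr_ge0 ?occ_ge0 // ltW.
have P2 : mu m.+1 * (N%:R * occ s m.+1) * (expR (step_low m.+1) - 1) <=
   mu m.+1 * (N%:R * occ s m.+1) * (step_low m.+1 * (1 + 2 * step_low m.+1)).
  by apply: ler_wpM2l => //; rewrite !mulr_ge0 ?occ_ge0 // ltW.
apply: le_trans (lerD P1 P2) _; rewrite [in X in _ <= X]He.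
rewrite le_eqVlt; apply/orP; left; apply/eqP.
have vr : mu m.+1 * v m.+1 = p m * mu m * v m := v_rec p mu_gt0 mM.
have v0 := v_gt0 (ltnW mM).
(* The balance [v_rec] gives the inflow the same factor [mu m.+1 * v m.+1] as the outflow. *)
have -> : p m * (mu m * (N%:R * occ s m)) = mu m.+1 * v m.+1 * (N%:R * (occ s m / v m)).
  by rewrite vr; move: (v m) v0 => w w0; field; rewrite gt_eqF.
move: (occ s m / v m) (step_low m.+1) => u h.
by move: (v m.+1) vm => w w0; field; rewrite gt_eqF.
Qed.

Lemma Gen_up s m : valid s -> (m < M)%N -> 0 <= step_up m <= 2^-1 ->
  Gen alpha mu p route (fun s => expR (eta * ugap s m)) s <=
  gtot mu p m / wt M mu p m * eta * (expR (eta * ugap s m) * kup s m).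
Proof.
move=> vs mM h01.
have -> : (fun s => expR (eta * ugap s m)) =
  lexp (- eta * ((1 - nu) * (\sum_(1 <= r < m.+1) v r) + off M mu p nu eps m) / wt M mu p m)
    (dup (step_up m) m).
  by apply/funext => s'; rewrite upgap_lexp.
have h0 : 0 <= step_up m by case/andP: h01.
apply: le_trans (Gen_lexp_le _ _ b_gt0 M_gt0 rt vs _ pe01 _) _.
- by move=> i; exact: mu_gt0.
- by rewrite /dup.
rewrite upgap_lexp // mulrCA; apply: ler_wpM2l; first exact: expR_ge0.
rewrite (eq_bigr (fun i : 'I_M => phase_rate M mu p (fun j => N%:R * occ s j)
  (dup (step_up m) m) i)); last by move=> i _; rewrite cnt_occ.
rewrite [dup _ _ 0]/dup /= expR0 subrr mulr0 add0r.
case: m mM h01 h0 => [|m] mM h01 h0; first by rewrite phase_up0 /kup mulr0.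
have e1 := expRB1_le h01; have e2 := expRNB1_le h0.
have wm := wt_gt0 v_gt0 m.+1 M_gt0.
have He : eta = step_up m.+1 * (N%:R * wt M mu p m.+1).
  by rewrite /step_up divfK // mulf_neq0 // gt_eqF.
rewrite phase_up // /kup.
have m1 := mu_gt0 mM; have m0 := mu_gt0 M_gt0.
have /andP[p0 _] : 0 <= p 0%N < 1 by apply: p01; lia.
have g0 : 0 < gtot mu p m.+1 by rewrite /gtot ltr_wpDl // mulr_ge0 // ltW.
have -> : \sum_(1 <= j < m.+1) (1 - p j) * mu j * (N%:R * occ s j) + mu m.+1 * (N%:R * occ s m.+1)
  = N%:R * (\sum_(1 <= j < m.+1) (1 - p j) * mu j * occ s j + mu m.+1 * occ s m.+1).
  by rewrite mulrDr mulr_sumr; congr (_ + _); [apply: eq_bigr => j _|]; ring.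
have : 0 <= \sum_(1 <= j < m.+1) (1 - p j) * mu j * occ s j + mu m.+1 * occ s m.+1.
  rewrite addr_ge0 ?mulr_ge0 ?occ_ge0 ?(ltW m1) // big_nat_cond sumr_ge0 // => j /andP[/andP[_ jm] _].
  have /andP[_ p1] := p01 (leq_ltn_trans jm mM).
  by rewrite !mulr_ge0 ?occ_ge0 ?subr_ge0 ?(ltW p1) // ltW // mu_gt0 // (ltn_trans jm) // ltnW.
move: (_ + _) => D D0.
have P1 : p 0%N * mu 0%N * (N%:R * occ s 0%N) * (expR (step_up m.+1) - 1) <=
   p 0%N * mu 0%N * (N%:R * occ s 0%N) * (step_up m.+1 * (1 + 2 * step_up m.+1)).
  by apply: ler_wpM2l => //; rewrite !mulr_ge0 ?occ_ge0 // ltW.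
have P2 : N%:R * D * (expR (- step_up m.+1) - 1) <=
   N%:R * D * - (step_up m.+1 * (1 - step_up m.+1)).
  by apply: ler_wpM2l => //; rewrite mulr_ge0.
apply: le_trans (lerD P1 P2) _; rewrite [in X in _ <= X]He.
rewrite le_eqVlt; apply/orP; left; apply/eqP.
move: (step_up m.+1) (wt _ _ _ _) wm (gtot _ _ _) g0 => h w w0 g g0.
by field; rewrite !gt_eqF.
Qed.

End FacetGenerator.

(** * Concentration *)

(* The mass of the facets within [eps] of the maximum is negative and dominates
   the remaining ones, which carry an extra factor [exp (- eta * eps)]. *)
Lemma exp_tail_bound {R : realType} {T I : finType} (pi : T -> R) (D : pred T)
    (Z kap : I -> T -> R) (eta eps K t0 t1 : R) (i0 : I) :
  (forall x, 0 <= pi x) -> (forall x, ~~ D x -> pi x = 0) -> \sum_x pi x = 1 ->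
  0 < eta -> 0 <= eps -> 0 <= K -> t0 <= t1 ->
  (forall i, 0 <= \sum_x pi x * (expR (eta * Z i x) * kap i x)) ->
  (forall x i, D x -> kap i x <= K) ->
  (forall x t, D x -> t0 <= t -> (forall j, Z j x <= t) ->
     forall i, t - eps <= Z i x -> kap i x <= - (eps / 2)) ->
  #|I|%:R * K * expR (- (eta * eps)) <= eps / 4 ->
  eps / 4 * expR (eta * t1) * \sum_(x | [exists i, t1 < Z i x]) pi x
    <= #|I|%:R * K * expR (eta * t0).
Proof.
move=> pi0 piD pi1 eta0 eps0 K0 t01 gen far near small.
set S := fun x => \sum_i expR (eta * Z i x) * kap i x.
have HS : 0 <= \sum_x pi x * S x.
  rewrite /S; under eq_bigr do rewrite mulr_sumr.
  by rewrite exchange_big sumr_ge0.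
(* Averaging this pointwise bound over [pi] and dropping the nonnegative mean of [S] gives the
   claim. *)
have key x : D x -> S x + eps / 4 * expR (eta * t1) * ([exists i, t1 < Z i x])%:R
    <= #|I|%:R * K * expR (eta * t0).
  move=> Dx; pose im := [arg max_(i > i0) Z i x]%O; pose t := Z im x.
  have tmax j : Z j x <= t.
    by rewrite /t /im; case: arg_maxP => // i _ /(_ j isT).
  have R0 : 0 <= #|I|%:R * K * expR (eta * t0) by rewrite !mulr_ge0 ?expR_ge0.
  (* Below [t0] the event fails, and each facet adds at most [K * expR (eta * t0)]. *)
  have [tt0|t0t] := ltP t t0.
    have -> : [exists i, t1 < Z i x] = false.
      apply/existsP => -[i Hi]; have := tmax i; lra.
    rewrite mulr0 addr0; apply: (@le_trans _ _ (\sum_(i : I) K * expR (eta * t0))).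
      apply: ler_sum => i _; rewrite mulrC.
      apply: (@le_trans _ _ (K * expR (eta * Z i x))).
        by rewrite ler_wpM2r ?expR_ge0 // far.
      rewrite ler_wpM2l // ler_expR ler_wpM2l ?(ltW eta0) //.
      by have := tmax i; lra.
    by rewrite sumr_const -[X in X <= _]mulr_natl mulrA.
  have e0 : 0 < expR (eta * t) by rewrite expR_gt0.
  have Sle : S x <= - (eps / 4) * expR (eta * t).
    rewrite /S (bigD1 im) //= -/t.
    have H1 : expR (eta * t) * kap im x <= expR (eta * t) * - (eps / 2).
      by rewrite ler_wpM2l ?(ltW e0) // (near x t) // -/t; lra.
    have H2 : \sum_(i | i != im) expR (eta * Z i x) * kap i x <=
        \sum_(i : I) K * (expR (eta * t) * expR (- (eta * eps))).
      rewrite [leRHS](bigD1 im) //= ler_wpDl ?mulr_ge0 ?expR_ge0 //.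
      apply: ler_sum => i _.
      have [Hi|Hi] := lerP (t - eps) (Z i x).
        apply: (@le_trans _ _ 0); last by rewrite !mulr_ge0 ?expR_ge0.
        rewrite mulr_ge0_le0 ?expR_ge0 // (le_trans (near x t Dx t0t tmax i Hi)) //.
        by lra.
      rewrite mulrC; apply: (@le_trans _ _ (K * expR (eta * Z i x))).
        by rewrite ler_wpM2r ?expR_ge0 // far.
      rewrite ler_wpM2l // -expRD ler_expR -mulrN -mulrDr ler_wpM2l ?(ltW eta0) //.
      by lra.
    move: H2; rewrite sumr_const -mulr_natl => H2.
    have := ler_wpM2r (ltW e0) small; move: H1 H2; lra.
  apply: le_trans R0; case: existsP => [[i Hi]|_].
    have e1 : expR (eta * t1) <= expR (eta * t).
      rewrite ler_expR ler_wpM2l ?(ltW eta0) //; have := tmax i; lra.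
    have e4 : 0 <= eps / 4 by lra.
    by have := ler_wpM2l e4 e1; rewrite mulr1; lra.
  rewrite mulr0 addr0 (le_trans Sle) // mulNr oppr_le0 mulr_ge0 ?(ltW e0) //; lra.
have : \sum_x pi x * (S x + eps / 4 * expR (eta * t1) * ([exists i, t1 < Z i x])%:R)
   <= \sum_x pi x * (#|I|%:R * K * expR (eta * t0)).
  apply: ler_sum => x _; have [Dx|/piD ->] := boolP (D x); last by rewrite !mul0r.
  by rewrite ler_wpM2l // key.
rewrite -mulr_suml pi1 mul1r; apply: le_trans.
under [leRHS]eq_bigr do rewrite mulrDr.
rewrite big_split /= ler_wpDl // mulr_sumr big_mkcond /=.
apply: ler_sum => x _; case: ifP => _; rewrite ?mulr1 ?mulr0 //.
by rewrite mulrC.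
Qed.

(** * Stationary tail of the phase deficits *)

Section Concentration.
Context {R : realType} {N b M : nat}.
Implicit Types (s : state N b M).
Context (alpha : R) (mu p : nat -> R) (route : state N b M -> option ('I_b * 'I_M) -> R).
Context (pi : state N b M -> R) (eps vb : R).
Local Notation v := (v mu p).
Local Notation nu := (1 - lam N alpha).
Local Notation lgap s := (lowgap mu p nu eps (occ s)).
Local Notation ugap s := (upgap M mu p nu eps (occ s)).
Local Notation eta := (N%:R * vb * eps / 4).
Local Notation kl := (klow alpha mu p route eta).
Local Notation ku := (kup mu p eta).

Hypothesis N_gt0 : (0 < N)%N.
Hypothesis b_gt0 : (0 < b)%N.
Hypothesis M_gt1 : (1 < M)%N.
Hypothesis mu_gt0 : forall m, (m < M)%N -> 0 < mu m.
Hypothesis v_ge : forall m, (m < M)%N -> vb <= v m.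
Hypothesis vb01 : 0 < vb <= 1.
Hypothesis p01 : forall m, (m.+1 < M)%N -> 0 <= p m < 1.
Hypothesis v_sum : \sum_(0 <= m < M) v m = 1.
Hypothesis lam01 : 0 <= lam N alpha <= 1.
Hypothesis rt : routing route.
Hypothesis eps01 : 0 < eps <= 4^-1.
Hypothesis mu0_ge1 : 1 <= mu 0%N.
Hypothesis A1_small : forall s, valid s ->
  s1 s <= lam N alpha + eps * v 0%N + off M mu p nu eps M.-1 ->
  A1 route s <= mu 0%N * eps.

Let M_gt0 : (0 < M)%N. Proof. exact: ltnW. Qed.
Let vb0 : 0 < vb. Proof. by case/andP: vb01. Qed.
Let eps0 : 0 < eps. Proof. by case/andP: eps01. Qed.
Let v_gt0 m : (m < M)%N -> 0 < v m.
Proof. by move=> mM; apply: lt_le_trans (v_ge mM). Qed.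
Let N0 : 0 < N%:R :> R. Proof. by rewrite ltr0n. Qed.
Let eta0 : 0 < eta. Proof. by rewrite divr_gt0 // !mulr_gt0. Qed.

(** This explains the constant in [eta]: jumps of at most [eps / 4] keep the second-order terms of
    the exponentials below the drift. *)
Lemma step_bound w : vb <= w -> 0 <= eta / (N%:R * w) <= eps / 4.
Proof.
move=> vw; have w0 : 0 < w by apply: lt_le_trans vw.
rewrite divr_ge0 ?(ltW eta0) ?mulr_ge0 ?(ltW w0) //=.
rewrite ler_pdivrMr ?mulr_gt0 //.
have c0 : 0 <= N%:R * eps / 4 by rewrite divr_ge0 ?mulr_ge0 ?(ltW eps0).
by have := ler_wpM2l c0 vw; lra.
Qed.

Lemma step_low_bound m : (m < M)%N -> 0 <= step_low (N := N) mu p eta m <= eps / 4.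
Proof. by move=> mM; apply: step_bound; exact: v_ge. Qed.

Lemma step_up_bound m : 0 <= step_up (N := N) (M := M) mu p eta m <= eps / 4.
Proof.
apply: step_bound; apply: (le_trans (v_ge M_gt0)).
rewrite /wt lerDl big_nat_cond sumr_ge0 // => i /andP[/andP[_ iM] _].
by rewrite ltW ?v_gt0.
Qed.

Lemma occ_le1 s m : (m < M)%N -> valid s -> occ s m <= 1 :> R.
Proof.
move=> mM vs; apply: le_trans (sum_occ_le1 N_gt0 vs).
rewrite big_mkord (bigD1 (Ordinal mM)) //= lerDl sumr_ge0 // => i _.
exact: occ_ge0.
Qed.

Lemma A1_01 s : valid s -> 0 <= A1 route s <= 1.
Proof.
move=> vs; have [r0 [r1 _]] := rt vs.
by rewrite sumr_ge0 //= -r1 [leRHS](bigD1 None) //= sum_Some lerDr r0.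
Qed.

Lemma klow_le s m : valid s -> (m < M)%N -> kl s m <= 2 / vb.
Proof.
move=> vs mM; have := step_low_bound mM; rewrite /klow.
move: (step_low _ _ _ _) => h /andP[h0 h1].
have /andP[A0 A1'] := A1_01 vs; have /andP[l0 l1] := lam01.
have He := andP eps01.
have B0 : 0 <= (if m is k.+1 then occ s k / v k else lam N alpha * (1 - A1 route s)).
  case: m mM => [|k] kM; first by rewrite mulr_ge0 // subr_ge0.
  by rewrite divr_ge0 ?occ_ge0 // ltW // v_gt0 // ltnW.
have B1 : occ s m / v m <= vb^-1.
  rewrite ler_pdivrMr ?v_gt0 //; apply: (le_trans (occ_le1 mM vs)).
  by rewrite -ler_pdivrMl ?invr_gt0 // invrK mulr1 v_ge.
have B2 : 0 <= occ s m / v m by rewrite divr_ge0 ?occ_ge0 // ltW // v_gt0.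
move: (if m is _.+1 then _ else _) B0 (occ s m / v m) B1 B2 => u u0 d d1 d0.
case: He => _ e4; have i0 : 0 < vb^-1 by rewrite invr_gt0.
have : 0 <= u * (1 - h) by rewrite mulr_ge0 //; lra.
have : d * (1 + 2 * h) <= vb^-1 * 2 by apply: ler_pM => //; lra.
by lra.
Qed.

Lemma up_le_gtot s m : valid s -> (m.+1 < M)%N ->
  0 <= p 0%N * mu 0%N * occ s 0%N <= gtot mu p m.+1 /\ 0 < gtot mu p m.+1.
Proof.
move=> vs mM; have /andP[p0 _] : 0 <= p 0%N < 1 by apply: p01; lia.
have m0 := mu_gt0 M_gt0; have m1 := mu_gt0 mM.
have q0 : 0 <= p 0%N * mu 0%N by rewrite mulr_ge0 // ltW.
have := ler_wpM2l q0 (occ_le1 M_gt0 vs); rewrite mulr1 /gtot => H.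
by rewrite mulr_ge0 ?occ_ge0 //; split; lra.
Qed.

Lemma kup_le s m : valid s -> (m < M)%N -> ku s m <= 2 / vb.
Proof.
move=> vs mM; have i1 : 1 <= vb^-1 by rewrite invf_ge1 //; case/andP: vb01.
case: m mM => [|m] mM /=; first by rewrite mulr_ge0 // ltW // invr_gt0.
have := step_up_bound m.+1; move: (step_up _ _ _ _) => h /andP[h0 h1].
have [/andP[u0 ug] g0] := up_le_gtot vs mM.
have : 0 <= \sum_(1 <= j < m.+1) (1 - p j) * mu j * occ s j + mu m.+1 * occ s m.+1.
  rewrite addr_ge0 ?mulr_ge0 ?occ_ge0 ?(ltW (mu_gt0 mM)) //.
  rewrite big_nat_cond sumr_ge0 // => j /andP[/andP[_ jm] _].
  have /andP[_ p1] := p01 (leq_ltn_trans jm mM).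
  by rewrite !mulr_ge0 ?occ_ge0 ?subr_ge0 ?(ltW p1) // ltW // mu_gt0 // (ltn_trans jm) // ltnW.
move: (_ + _) => D D0; rewrite ler_pdivrMr //.
have /andP[_ e4] := eps01.
have : 0 <= D * (1 - h) by rewrite mulr_ge0 //; lra.
have : p 0%N * mu 0%N * occ s 0%N * (1 + 2 * h) <= gtot mu p m.+1 * 2.
  by apply: ler_pM => //; lra.
have : gtot mu p m.+1 * 2 <= 2 / vb * gtot mu p m.+1.
  by rewrite mulrC ler_wpM2r ?(ltW g0) //; lra.
by lra.
Qed.

Lemma bracket_le (d r h : R) : 0 <= h -> d <= 1 -> r <= 1 ->
  d * (1 + 2 * h) - r * (1 - h) <= d - r + 3 * h.
Proof.
move=> h0 d1 r1.
have := ler_wpM2r h0 d1; have := ler_wpM2r h0 r1; lra.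
Qed.

Section Near.
Context (s : state N b M) (t : R).
Hypothesis vs : valid s.
Hypothesis t_ge : 4 * mu 0%N * eps <= t.
Hypothesis low_le : forall m, (m < M)%N -> lgap s m <= t.
Hypothesis up_le : forall m, (m < M)%N -> ugap s m <= t.

Let t_eps : 4 * eps <= t.
Proof. by have := ler_wpM2r (ltW eps0) mu0_ge1; move: t_ge; lra. Qed.

Lemma klow_near m : (m < M)%N -> t - eps <= lgap s m -> kl s m <= - (eps / 2).
Proof.
move=> mM Hm; have /andP[h0 h1] := step_low_bound mM.
have /andP[A0 A1'] := A1_01 vs; have /andP[l0 l1] := lam01.
have d1 : occ s m / v m <= 1.
  by move: Hm; rewrite /lowgap; have : 0 <= 5 * m%:R * eps; [rewrite !mulr_ge0 // ltW|move: t_eps eps0; lra].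
rewrite /klow; case: m mM Hm h0 h1 d1 => [|k] kM Hm h0 h1 d1.
  (* The first deficit is near [t] and the last excess at most [t], so [x_sum_near] puts [s1] in the
     range of [A1_small]. *)
  have As : A1 route s <= mu 0%N * eps.
    apply: A1_small => //; rewrite -(sum_occE (R := R)).
    have lM : (M.-1 < M)%N by rewrite prednK.
    by have := x_sum_near v_gt0 v_sum M_gt0 (up_le lM) Hm; rewrite subKr.
  have r1 : lam N alpha * (1 - A1 route s) <= 1.
    by rewrite mulr_ile1 //; lra.
  apply: (le_trans (bracket_le h0 d1 r1)).
  have : lam N alpha * A1 route s <= mu 0%N * eps.
    apply: le_trans As; rewrite -{2}[A1 route s]mul1r ler_wpM2r //.
  have := ler_wpM2r (ltW eps0) mu0_ge1.
  by move: Hm t_ge; rewrite /lowgap mulr0 mul0r; lra.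
(* The ratio [occ s k / v k] may exceed 1, so [bracket_le] is applied to the lower bound that [lk]
   provides. *)
have lk := low_le (ltnW kM).
have hN : 0 <= 1 - step_low (N := N) mu p eta k.+1 by have /andP[_ e4] := eps01; lra.
have u1 : 1 - nu - t - 5 * k%:R * eps <= occ s k / v k.
  by move: lk; rewrite /lowgap; lra.
have r1 : 1 - nu - t - 5 * k%:R * eps <= 1.
  have : 0 <= 5 * k%:R * eps by rewrite !mulr_ge0 // ltW.
  by move: l1 t_eps eps0; lra.
have := ler_wpM2r hN u1.
have := bracket_le h0 d1 r1.
move: Hm; rewrite /lowgap -natr1.
by lra.
Qed.

Lemma kup_near m : (m < M)%N -> t - eps <= ugap s m -> ku s m <= - (eps / 2).
Proof.
case: m => [|m] mM Hm.
  (* The block is empty and [upgap] is 0, whereas [t - eps] is at least [3 * eps]. *)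
  exfalso; move: Hm; rewrite /upgap /off /= !big_geq // mulr0 !subr0 mul0r.
  by move: t_eps eps0; lra.
have /andP[h0 h1] := step_up_bound m.+1.
have [/andP[u0 ug] g0] := up_le_gtot vs mM.
have := updown_near mu_gt0 v_gt0 p01 v_sum (sum_occ_le1 N_gt0 vs) (ltW eps0) mM
  low_le (up_le (ltnW mM)) Hm.
rewrite /updown /= ler_pdivrMr //.
move: (step_up _ _ _ _) h0 h1 (_ + mu m.+1 * _) => h h0 h1 D.
move: (gtot _ _ _) g0 (p 0%N * mu 0%N * _) u0 ug => g g0 u u0 ug Hud.
have /andP[_ e4] := eps01.
(* The numerator is [(u - D) * (1 - h) + 3 * h * u], with [u <= g] and [h] at most 1/16. *)
have hN : 0 <= 1 - h by lra.
have H1 := ler_wpM2r hN Hud.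
have H2 : h * u <= eps / 4 * g by rewrite ler_pM.
have H4 : 0 < eps * g by rewrite mulr_gt0.
have H3 : 0 <= eps * g * (1 / 16 - h) by rewrite mulr_ge0 ?mulr_ge0 ?(ltW eps0) ?(ltW g0) //; lra.
by lra.
Qed.

End Near.

Hypothesis st : stationary alpha mu p route pi.
Hypothesis small : 2 * M%:R * (2 / vb) * expR (- (eta * eps)) <= eps / 4.

(** [exp_tail_bound] is applied to all [2 * M] facets together, since the drift of each near the
    maximum depends on the bounds for the others; the deficits are then singled out. *)
Lemma lowgap_tail :
  eps / 4 * expR (eta * (6 * mu 0%N * eps)) *
    Prob pi [pred s | [exists m : 'I_M, 6 * mu 0%N * eps < lgap s m]]
  <= 2 * M%:R * (2 / vb) * expR (eta * (4 * mu 0%N * eps)).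
Proof.
pose Z (i : bool * 'I_M) s := if i.1 then lgap s i.2 else ugap s i.2.
pose K (i : bool * 'I_M) s := if i.1 then kl s i.2 else ku s i.2.
have [pi0 [piD [pi1 _]]] := st.
have cI : #|{: bool * 'I_M}|%:R = 2 * M%:R :> R.
  by rewrite card_prod card_bool card_ord natrM.
have mu0 := mu_gt0 M_gt0.
have /andP[l0 _] := lam01; have /andP[_ e4] := eps01.
have gen i : 0 <= \sum_s pi s * (expR (eta * Z i s) * K i s).
  have S0 := stationary_Gen (fun s => expR (eta * Z i s)) st.
  pose C := if i.1 then mu i.2 * eta else gtot mu p i.2 / wt M mu p i.2 * eta.
  have C0 : 0 < C.
    rewrite /C; case: i.1; first by rewrite mulr_gt0 // mu_gt0.
    rewrite mulr_gt0 // divr_gt0 ?wt_gt0 // /gtot ltr_wpDl ?mu_gt0 //.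
    by have /andP[p0 _] := p01 M_gt1; rewrite mulr_ge0 // ltW.
  (* The generator has mean zero under [pi] and is at most [C] times the integrand on valid states,
     so the integrand has nonnegative mean. *)
  rewrite -(pmulr_rge0 _ C0) mulr_sumr; have := lexx (0 : R).
  rewrite -{2}S0 => /le_trans; apply; apply: ler_sum => s _.
  have [vs|/piD ->] := boolP (valid s); last by rewrite !mul0r mulr0.
  rewrite mulrCA; apply: ler_wpM2l => //.
  rewrite /C /Z /K; clear C0 C S0; case: i => -[] m /=.
    apply: Gen_low => //; have := step_low_bound (ltn_ord m); lra.
  by apply: Gen_up => //; have := step_up_bound m; lra.
have far s i : valid s -> K i s <= 2 / vb.
  by move=> vs; rewrite /K; case: i => -[] m /=; [exact: klow_le | exact: kup_le].
have near s t : valid s -> 4 * mu 0%N * eps <= t -> (forall j, Z j s <= t) ->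
    forall i, t - eps <= Z i s -> K i s <= - (eps / 2).
  move=> vs Ht Hj [[] m] /=; [apply: klow_near | apply: kup_near] => // k kM.
  - exact: (Hj (true, Ordinal kM)).
  - exact: (Hj (false, Ordinal kM)).
  - exact: (Hj (true, Ordinal kM)).
  - exact: (Hj (false, Ordinal kM)).
have t01 : 4 * mu 0%N * eps <= 6 * mu 0%N * eps.
  by rewrite ler_wpM2r ?(ltW eps0) // ler_wpM2r ?(ltW mu0) // ler_nat.
have K0 : 0 <= 2 / vb by rewrite divr_ge0 // ltW.
have small' := small; rewrite -cI in small' *.
have := exp_tail_bound (true, Ordinal M_gt0) pi0 piD pi1 eta0 (ltW eps0) K0 t01
  gen far near small'.
apply: le_trans; apply: ler_wpM2l; first by rewrite mulr_ge0 ?expR_ge0 // divr_ge0 // ltW.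
rewrite /Prob big_mkcond [leRHS]big_mkcond /=; apply: ler_sum => s _.
case: ifP => [/existsP[m Hm]|_]; last by case: ifP.
by rewrite ifT //; apply/existsP; exists (true, m).
Qed.

End Concentration.

(** * Constants *)

Lemma linrec_ge {R : realType} (a e : nat -> R) (k : R) m :
  0 <= k -> (0 < m)%N ->
  (forall r, (0 < r <= m)%N -> 0 <= a r /\ k <= e r) -> k <= linrec a e m.
Proof.
move=> k0; elim: m => // m IH _ H /=.
have [a0 ke] := H m.+1 (leqnn _).
have [m0|m0] := posnP m; first by move: ke; rewrite m0 /= mulr0 add0r.
have Hm : k <= linrec a e m.
  by apply: IH => // r /andP[r0 rm]; apply: H; rewrite r0 leqW.
by rewrite ler_wpDl // mulr_ge0 // (le_trans k0).
Qed.

Section Constants.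
Context {R : realType} (M : nat) (mu p : nat -> R).
Local Notation v := (v mu p).
Local Notation a := (a_ mu p).
Local Notation c := (c_ M mu p).
Local Notation ell := (ln (xi M mu p)^-1).

Hypothesis M_gt0 : (0 < M)%N.
Hypothesis mu_gt0 : forall m, (m < M)%N -> 0 < mu m.
Hypothesis p01 : forall m, (m.+1 < M)%N -> 0 <= p m < 1.
Hypothesis v_sum : \sum_(m < M) v m = 1.
Hypothesis xi01 : 0 < xi M mu p < 1.

Lemma v_ge0 m : (m < M)%N -> 0 <= v m.
Proof.
move=> mM; rewrite /v divr_ge0 ?(ltW (mu_gt0 _)) // big_nat_cond prodr_ge0 //.
by move=> i /andP[/andP[_ im] _]; have /andP[] := p01 (leq_ltn_trans im mM).
Qed.

Lemma vbar_le m : (m < M)%N -> vbar M mu p <= v m.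
Proof. by move=> mM; rewrite /vbar (bigmin_le_cond _ _ (j := Ordinal mM)). Qed.

Lemma vbar_ge0 : 0 <= vbar M mu p.
Proof. by rewrite /vbar; apply/bigmin_geP; split => // i _; exact: v_ge0. Qed.

Lemma vbar_le1 : vbar M mu p <= 1.
Proof. exact: bigmin_le_id. Qed.

(** With a single phase [xi] is an empty sum, contrary to [0 < xi]. *)
Lemma M_gt1 : (1 < M)%N.
Proof.
by rewrite ltnNge; apply/negP => M1; move: xi01; rewrite /xi big_geq // ltxx.
Qed.

Lemma M_vbar : M%:R * vbar M mu p <= 1.
Proof.
rewrite mulr_natl -[X in _ *+ X]card_ord -sumr_const -[leRHS]v_sum.
by apply: ler_sum => i _; exact: vbar_le.
Qed.

Lemma mu0_ge1 : 1 <= mu 0%N.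
Proof.
have m0 := mu_gt0 M_gt0; have v1 := v0mu0 p mu_gt0 M_gt0.
rewrite -v1 ler_piMl ?(ltW m0) // -v_sum (bigD1 (Ordinal M_gt0)) //=.
by rewrite lerDl sumr_ge0 // => i _; exact: v_ge0.
Qed.

Lemma a_01 m : (m < M)%N -> 0 <= a m <= 1.
Proof.
move=> mM; have m1 := mu_gt0 mM; have m0 := mu_gt0 M_gt0.
have /andP[p0 _] := p01 M_gt1.
have q0 : 0 <= p 0%N * mu 0%N by rewrite mulr_ge0 // ltW.
rewrite /a_ divr_ge0 ?addr_ge0 ?(ltW m1) //=.
by rewrite ler_pdivrMr ?mul1r ?lerDr // ltr_wpDl.
Qed.

(** The first two terms form a particular solution, equal to [wt m / v 0], and the product solves
    the homogeneous recursion; the initial value 0 fixes its factor, [mu 0] being the inverse of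
    [v 0]. *)
Lemma linrec_b m : (m < M)%N -> linrec a (b_ M mu p) m =
  1 + \sum_(m.+1 <= r < M) v r / v 0%N - mu 0%N * \prod_(1 <= j < m.+1) a j.
Proof.
have v1 := v0mu0 p mu_gt0 M_gt0.
have v0 : v 0%N != 0 by apply/eqP => e; move: v1; rewrite e mul0r => /eqP; rewrite eq_sym oner_eq0.
elim: m => [|m IH] mM /=.
  rewrite [\prod_(1 <= j < 1) _]big_geq // mulr1 -mulr_suml.
  have := v_sum; rewrite -(big_mkord xpredT) big_ltn // => vs.
  have -> : \sum_(1 <= i < M) v i = 1 - v 0%N by rewrite -vs addrC addKr.
  have -> : mu 0%N = (v 0%N)^-1 by apply: (mulfI v0); rewrite v1 divff.
  by field.
rewrite IH ?(ltnW mM) // [\prod_(1 <= j < m.+2) _]big_nat_recr //=.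
rewrite big_ltn // /b_; ring.
Qed.

Lemma xiE : 1 - xi M mu p = mu 0%N * \prod_(1 <= j < M) a j.
Proof.
have := linrec_b (m := M.-1); rewrite linrecE prednK // => /(_ (leqnn _)).
by rewrite -/(xi M mu p) => ->; rewrite [\sum_(M <= r < M) _]big_geq // addr0; ring.
Qed.

Lemma c_ge4 m : (0 < m < M)%N -> 4 <= c m.
Proof.
move=> /andP[m0 mM]; have /andP[a0 a1] := a_01 mM.
rewrite /c_ -addrA; apply: ler_wpDl; last by lra.
have -> : m%:R - 1 = m.-1%:R :> R by rewrite -[in LHS](prednK m0) -natr1 addrK.
have S1 : 0 <= \sum_(m.+1 <= r < M) r%:R * v r.
  rewrite big_nat_cond sumr_ge0 // => r /andP[/andP[_ rM] _].
  by rewrite mulr_ge0 // v_ge0.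
have S2 : 0 <= \sum_(1 <= r < m) mu r * v r / mu m.
  rewrite big_nat_cond sumr_ge0 // => r /andP[/andP[_ rm] _].
  have rM := ltn_trans rm mM.
  rewrite divr_ge0 ?(ltW (mu_gt0 mM)) // mulr_ge0 ?v_ge0 //.
  exact: ltW (mu_gt0 rM).
have a2 : 0 <= 1 - a m by rewrite subr_ge0.
have vm := v_ge0 mM; move: (a m) (v m) a0 a2 vm S1 S2 => y w y0 y1 w0 S1 S2.
by apply: addr_ge0; first apply: addr_ge0; rewrite !mulr_ge0.
Qed.

Lemma CM_ge4 : 4 <= CM M mu p.
Proof.
have M1 := M_gt1; have M0 : (0 < M.-1)%N by lia.
have := @linrec_ge _ a c 4 M.-1 (ler0n _ _) M0.
rewrite linrecE prednK // -/(CM M mu p); apply => r /andP[r0 rM].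
have rM' : (r < M)%N by lia.
by have /andP[] := a_01 rM'; split => //; apply: c_ge4; rewrite r0.
Qed.

(** By linearity the part in [nu] is given by [linrec1B] and [xiE]. The recursion with constant
    input 1 is at least 1, which yields the [- 1] next to [CM]. *)
Lemma off_le nu eps : 0 <= eps ->
  off M mu p nu eps M.-1 <= nu * (1 - (1 - xi M mu p) / mu 0%N) + eps * (CM M mu p - 1).
Proof.
move=> eps0; have M1 := M_gt1; have M0 : (0 < M.-1)%N by lia.
have m0 := mu_gt0 M_gt0.
rewrite /off linrecD linrec1B prednK // xiE.
have -> : linrec a (fun r => c r - 1) M.-1 = CM M mu p - linrec a (fun=> 1) M.-1.
  rewrite (_ : (fun r => c r - 1) = (fun r => c r * 1 + (- 1) * 1)).
    by rewrite (linrecD a c (fun=> 1)) mulr1 mulN1r [linrec a c _]linrecE prednK.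
  by apply/funext => r; rewrite mulr1 mulr1.
have one : 1 <= linrec a (fun=> 1) M.-1.
  apply: linrec_ge => // r /andP[r0 rM].
  have rM' : (r < M)%N by lia.
  by have /andP[] := a_01 rM'.
have -> : mu 0%N * (\prod_(1 <= j < M) a j) / mu 0%N = \prod_(1 <= j < M) a j.
  by rewrite mulrC mulKf // gt_eqF.
rewrite mulrC lerD2l ler_wpM2l //; lra.
Qed.

Lemma ell_gt0 : 0 < ell.
Proof.
have /andP[x0 x1] := xi01.
by rewrite ln_gt0 // invf_gt1.
Qed.

(** Dropping [3 * M] from the denominator makes the logarithm of [xi] cancel. *)
Lemma Cc_sqr : Cc M mu p ^+ 2 * (3 * M%:R + 4) <= 2 * vbar M mu p ^+ 2.
Proof.
have l0 := ell_gt0; have m0 : 0 <= M%:R :> R by [].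
have d0 : 0 < 3 * M%:R + (3 * M%:R + 4) * ell.
  by rewrite ltr_wpDl ?mulr_ge0 // mulr_gt0 //; lra.
have v0 : 0 <= 2 * vbar M mu p ^+ 2 by rewrite mulr_ge0 // sqr_ge0.
rewrite /Cc sqr_sqrtr; last by rewrite divr_ge0 ?(ltW d0) // mulr_ge0 // ltW.
have H : ell * (3 * M%:R + 4) <= 3 * M%:R + (3 * M%:R + 4) * ell.
  by rewrite mulrC lerDr mulr_ge0.
by rewrite mulrAC ler_pdivrMr //; have := ler_wpM2l v0 H; rewrite mulrA.
Qed.

(** Some [p m] may vanish, and then [vbar] and [Cc] could be 0; a positive [L] below the minimum
    excludes this, because the second entry is proportional to [Cc]. *)
Lemma Cc_gt0 (L r : R) : 0 < L -> 0 <= r ->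
  L <= Num.min (\sum_(m < M) theta M mu p m)
            (Cc M mu p * (1 - xi M mu p) / (2 * mu 0%N * CM M mu p)) * r ->
  0 < Cc M mu p.
Proof.
move=> L0 r0; rewrite lt0r sqrtr_ge0 andbT; apply: contraTneq => C0.
rewrite -ltNge (le_lt_trans _ L0) // mulr_le0_ge0 // ge_min C0 !mul0r lexx orbT //.
Qed.

Lemma vbar_gt0 : 0 < Cc M mu p -> 0 < vbar M mu p.
Proof.
move=> C0; rewrite lt0r vbar_ge0 andbT; apply: contraTneq C0 => e.
by rewrite /Cc e expr0n /= mulr0 !mul0r sqrtr0 ltxx.
Qed.

Lemma Cc_le1 : Cc M mu p <= 1.
Proof.
rewrite -(@ler_pXn2r _ 2) ?nnegrE ?sqrtr_ge0 // expr1n.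
have := Cc_sqr; have := sqr_ge0 (Cc M mu p).
have : vbar M mu p ^+ 2 <= 1 by rewrite expr_le1 ?vbar_ge0 ?vbar_le1.
have : 0 <= M%:R :> R by []; move: (M%:R) (_ ^+ 2) (_ ^+ 2) => n u w n0 u1 w0.
have := mulr_ge0 w0 n0; lra.
Qed.

End Constants.

(** * Numerical estimates for the exponent *)

Lemma exp_poly_bound {R : realType} (y : R) : 1 <= y -> 16 * y ^+ 2 * expR (- (4 * y)) <= 1.
Proof.
move=> y1; rewrite expRN ler_pdivrMr ?expR_gt0 // mul1r.
have E : expR (4 * y) = expR y ^+ 4 by rewrite -expRM_natl.
have H : 1 + y <= expR y := expR_ge1Dx y.
rewrite E; apply: (@le_trans _ _ ((1 + y) ^+ 4)); last first.
  by rewrite ler_pXn2r // nnegrE; lra.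
have : 4 * y <= (1 + y) ^+ 2 by have := sqr_ge0 (1 - y); lra.
move=> H2; have : (4 * y) ^+ 2 <= ((1 + y) ^+ 2) ^+ 2.
  by rewrite ler_pXn2r // nnegrE ?sqr_ge0 //; lra.
by rewrite -exprM; lra.
Qed.

(** [A] stands for [eta * eps] and equals [vb * L ^+ 2 / (4 * C ^+ 2)]. As [m >= 2], the bound on
    [C] gives [A >= 5 / 2 * L / vb], which exceeds both [3 * L] and [L / 2 + 4 / vb]; the
    exponential of the latter absorbs the prefactor. *)
Lemma exponent_bounds {R : realType} (vb m C L : R) :
  2 <= L -> 0 < C <= 1 -> 0 < vb -> m * vb <= 1 -> 2 <= m ->
  C ^+ 2 * (3 * m + 4) <= 2 * vb ^+ 2 ->
  let sN := expR (L / 2) in let eps := L / (C * sN) in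
  let A := sN ^+ 2 * vb * eps / 4 * eps in
  2 * m * (2 / vb) * expR (- A) <= eps / 4 /\ 3 * L <= A.
Proof.
move=> L2 /andP[C0 C1] vb0 mvb m2 HC sN eps A.
have s0 : 0 < sN by exact: expR_gt0.
have AE : A = vb * (L ^+ 2 / (4 * C ^+ 2)).
  by rewrite /A /eps; field; rewrite !gt_eqF.
pose y := vb^-1.
have y0 : 0 < y by rewrite invr_gt0.
have my : m <= y by rewrite -[y]mul1r ler_pdivlMr.
have yA : 5 / 2 * L * y <= A.
  have -> : A = L ^+ 2 * vb ^+ 2 / (4 * C ^+ 2) * y.
    by rewrite AE /y; field; rewrite !gt_eqF.
  rewrite ler_wpM2r ?(ltW y0) //.
  have C20 : 0 < 4 * C ^+ 2 by rewrite mulr_gt0 // exprn_gt0.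
  rewrite ler_pdivlMr //.
  have H1 : C ^+ 2 * 10 <= 2 * vb ^+ 2.
    apply: le_trans HC; rewrite ler_wpM2l ?sqr_ge0 //; lra.
  have H2 := ler_wpM2l (sqr_ge0 L) H1.
  have H3 : 0 <= C ^+ 2 * L * (L - 2) by rewrite !mulr_ge0 ?sqr_ge0 //; lra.
  by lra.
have Ly : L <= L * y by rewrite ler_pMr; lra.
have yL : 2 * y <= L * y by rewrite ler_wpM2r // ltW.
split; last first.
  have : L * 2 <= L * y by rewrite ler_wpM2l; lra.
  by lra.
have E1 : expR (- A) <= sN^-1 * expR (- (4 * y)).
  by rewrite /sN -expRN -expRD ler_expR; lra.
have y1 : 1 <= y by lra.
have E2 := exp_poly_bound y1.
have i0 : 0 <= sN^-1 by rewrite invr_ge0 ltW.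
have H1 : 16 * m * y * expR (- A) <= 16 * y ^+ 2 * (sN^-1 * expR (- (4 * y))).
  apply: ler_pM => //; rewrite ?expR_ge0 // ?mulr_ge0 ?(ltW y0) //; first by lra.
  by rewrite -mulrA ler_wpM2l // expr2 ler_wpM2r // ltW.
have H2 : 16 * y ^+ 2 * (sN^-1 * expR (- (4 * y))) <= sN^-1.
  by have := ler_wpM2l i0 E2; lra.
have H3 : sN^-1 <= eps.
  by rewrite /eps invfM mulrA ler_peMl // ler_pdivlMr // mul1r; lra.
by rewrite -/y; lra.
Qed.

(** * From the tail bound to the phase fractions *)

Theorem theorem1 (R : realType) (N b M : nat) (alpha : R) (mu p : nat -> R)
  (route : state N b M -> option ('I_b * 'I_M) -> R) (pi : state N b M -> R) :
  (0 < N)%N -> (0 < b)%N -> (0 < M)%N -> 0 < alpha < 2^-1 ->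
  (forall m, (m < M)%N -> 0 < mu m) ->
  (forall m, (m.+1 < M)%N -> 0 <= p m < 1) ->
  \sum_(m < M) v mu p m = 1 ->
  0 < xi M mu p < 1 ->
  routing route -> LBzero alpha route ->
  irreducible alpha mu p route -> stationary alpha mu p route pi ->
  ln (N%:R : R) <=
    Num.min (\sum_(m < M) theta M mu p m)
            (Cc M mu p * (1 - xi M mu p) / (2 * mu 0%N * CM M mu p))
    * (N%:R `^ (2^-1 - alpha)) ->
  Num.max (2 * mu 0%N / (1 - xi M mu p)) (Cc M mu p / mu 0%N) <= ln (N%:R : R) ->
  forall m : 'I_M,
    1 - M%:R / (N%:R ^+ 3) <=
    Prob pi [pred x | (lam N alpha * v mu p m
                         - theta M mu p m * ln (N%:R : R) / Num.sqrt (N%:R) <= Sim x 1 m)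
                      && (Sim x 1 m <= lam N alpha * v mu p m + ((N%:R : R) `^ alpha)^-1
                         + (\sum_(r < M | r != m) theta M mu p r)
                           * ln (N%:R : R) / Num.sqrt (N%:R))].
Proof.
move=> N_gt0 b_gt0 M_gt0 /andP[alpha0 _] mu_gt0 p01 v_sum xi01 rt LB _ st HL HU m.
have M1 := M_gt1 xi01.
have v_sum' : \sum_(0 <= i < M) v mu p i = 1 by rewrite big_mkord.
have mu1 : 1 <= mu 0%N by apply: (@mu0_ge1 _ M mu p).
have mu0 : 0 < mu 0%N by apply: mu_gt0.
have /andP[xi0 xi1] := xi01.
set L := ln (N%:R : R) in HL HU *.
set C := Cc M mu p in HL HU.
move: HU; rewrite ge_max => /andP[HU1 HU2].
have L2 : 2 <= L.
  apply: le_trans HU1; rewrite ler_pdivlMr ?subr_gt0 //.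
  by lra.
have L0 : 0 < L by lra.
have C0 : 0 < C := Cc_gt0 L0 (powR_ge0 _ _) HL.
have C1 : C <= 1 by apply: Cc_le1.
set vb := vbar M mu p.
have vb0 : 0 < vb by apply: vbar_gt0.
have NR : (0 : R) < N%:R by rewrite ltr0n.
have NL : N%:R = expR L by rewrite lnK.
have sNE : Num.sqrt (N%:R : R) = expR (L / 2).
  rewrite NL -[RHS]gtr0_norm ?expR_gt0 // -sqrtr_sqr expr2 -expRD.
  by congr (Num.sqrt (expR _)); lra.
set sN := Num.sqrt (N%:R : R) in sNE *.
have s0 : 0 < sN by rewrite sqrtr_gt0.
have sN2 : sN ^+ 2 = N%:R by rewrite sqr_sqrtr // ltW.
pose eps := L / (C * sN).
have eps0 : 0 < eps by rewrite divr_gt0 // mulr_gt0.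
pose nu : R := N%:R `^ (- alpha).
have lamE : lam N alpha = 1 - nu by [].
have nu0 : 0 < nu by rewrite powR_gt0.
have nuE : nu = (N%:R `^ alpha)^-1 by rewrite /nu powRN.
have nu1 : nu <= 1.
  rewrite -[leRHS](powRr0 N%:R); apply: ler_powR; last by lra.
  by rewrite ler1n.
have CM0 := CM_ge4 M_gt0 mu_gt0 p01 xi01.
have epsC : eps * CM M mu p <= (1 - xi M mu p) * nu / (2 * mu 0%N).
  have : L <= C * (1 - xi M mu p) / (2 * mu 0%N * CM M mu p) * (sN * nu).
    have -> : sN * nu = N%:R `^ (2^-1 - alpha).
      rewrite powRD ?powR12_sqrt ?(ltW NR) //.
      by apply/implyP => _; rewrite gt_eqF.
    apply: le_trans HL _; rewrite ler_wpM2r ?powR_ge0 //.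
    by rewrite ge_min lexx orbT.
  have D0 : 0 < 2 * mu 0%N * CM M mu p by rewrite !mulr_gt0 //; lra.
  rewrite mulrAC ler_pdivlMr // => H.
  rewrite ler_pdivlMr ?mulr_gt0 //.
  have -> : eps * CM M mu p * (2 * mu 0%N) = L * (2 * mu 0%N * CM M mu p) / (C * sN).
    by rewrite /eps; ring.
  rewrite ler_pdivrMr ?mulr_gt0 //.
  by lra.
have eps4 : eps <= 4^-1.
  have H : (1 - xi M mu p) * nu / (2 * mu 0%N) <= 1.
    rewrite ler_pdivrMr ?mulr_gt0 // mul1r.
    have := ler_pM (_ : 0 <= 1 - xi M mu p) (ltW nu0) (_ : 1 - xi M mu p <= 1) nu1.
    by rewrite mul1r => /(_ ltac:(lra) ltac:(lra)); lra.
  have := ler_wpM2l (ltW eps0) CM0; lra.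
have mueps : sN^-1 <= mu 0%N * eps.
  rewrite /eps mulrA ler_pdivlMr ?mulr_gt0 // mulrCA mulVf ?gt_eqF // mulr1.
  by rewrite mulrC -ler_pdivrMr.
(* By [off_le] the bound on [s1] falls short of 1 by [nu * (1 - xi) / mu 0], up to terms in [eps].
   Half of this covers [eps * CM] by [epsC], the other half covers the threshold gap [nu / L] by
   [HU1]; the [- 1] next to [CM] pays for [eps * v 0]. *)
have A1_small s : valid s ->
    s1 s <= lam N alpha + eps * v mu p 0%N + off M mu p (1 - lam N alpha) eps M.-1 ->
    A1 route s <= mu 0%N * eps.
  move=> vs Hs; apply: le_trans mueps; apply: LB => //.
  apply: le_trans Hs _; rewrite lamE subKr invfM -nuE.
  have := off_le M_gt0 mu_gt0 p01 v_sum xi01 nu (ltW eps0).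
  have v1 : v mu p 0%N <= 1.
    rewrite -v_sum (bigD1 (Ordinal M_gt0)) //= lerDl sumr_ge0 // => i _.
    exact: (v_ge0 mu_gt0 p01).
  have := ler_wpM2l (ltW eps0) v1.
  have : L^-1 * nu <= (1 - xi M mu p) / (2 * mu 0%N) * nu.
    rewrite ler_wpM2r ?(ltW nu0) // -[X in _ <= X]invrK lef_pV2 ?posrE ?invr_gt0 ?divr_gt0 ?mulr_gt0 ?subr_gt0 //.
    by rewrite invf_div.
  move: epsC; rewrite [(1 - xi M mu p) * nu / _]mulrAC invfM.
  have -> : nu * (1 - (1 - xi M mu p) / mu 0%N) = nu - nu * ((1 - xi M mu p) / mu 0%N) by ring.
  move: (mu 0%N)^-1 => im.
  by lra.
have M2 : 2 <= M%:R :> R by rewrite ler_nat.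
have [small A3] := exponent_bounds L2 (introT andP (conj C0 C1)) vb0
  (M_vbar v_sum) M2 (Cc_sqr xi01).
have lam01 : 0 <= lam N alpha <= 1 by rewrite lamE subr_ge0 nu1 lerBlDr lerDl ltW.
rewrite -sNE sN2 -/eps in small A3.
have vb01 : 0 < vb <= 1 by rewrite vb0 vbar_le1.
have eps01 : 0 < eps <= 4^-1 by rewrite eps0.
have v_ge i : (i < M)%N -> vb <= v mu p i by exact: vbar_le.
have tail := lowgap_tail N_gt0 b_gt0 M1 mu_gt0 v_ge vb01 p01 v_sum' lam01 rt eps01 mu1
  A1_small st small.
set bad := [pred s | _] in tail.
have [pi0 [piD [pi1 _]]] := st.
have bad_le : Prob pi bad <= M%:R / N%:R ^+ 3.
  set eta := N%:R * vb * eps / 4 in small A3 tail.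
  have eta0 : 0 < eta by rewrite divr_gt0 // (mulr_gt0 (mulr_gt0 NR vb0) eps0).
  have H1 : 2 * M%:R * (2 / vb) * expR (eta * (4 * mu 0%N * eps)) <=
      eps / 4 * expR (eta * eps + eta * (4 * mu 0%N * eps)).
    rewrite expRD [leRHS]mulrA ler_wpM2r ?expR_ge0 //.
    by rewrite -ler_pdivrMr ?expR_gt0 // -expRN.
  have H2 : Prob pi bad <=
      expR (eta * eps + eta * (4 * mu 0%N * eps) - eta * (6 * mu 0%N * eps)).
    rewrite expRB ler_pdivlMr ?expR_gt0 //.
    have e40 : 0 < eps / 4 by rewrite divr_gt0.
    by rewrite -(ler_pM2l e40); have := le_trans tail H1; lra.
  (* The exponent is [eta * eps * (1 - 2 * mu 0)], at most [- (eta * eps)] because [mu 0 >= 1]; [A3]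
     then applies. *)
  apply: le_trans H2 _; apply: (@le_trans _ _ (expR (- (3 * L)))).
    rewrite ler_expR.
    have := ler_wpM2r (mulr_ge0 (ltW eta0) (ltW eps0)) mu1; lra.
  rewrite expRN expRM_natl -NL ler_peMl ?invr_ge0 ?exprn_ge0 ?(ltW NR) //.
  by lra.
set good := (X in Prob pi X).
rewrite lerBlDr; apply: (@le_trans _ _ (Prob pi good + Prob pi bad)); last first.
  by rewrite lerD2l.
rewrite -[leLHS]pi1 /Prob [X in X + _]big_mkcond [X in _ + X]big_mkcond /= -big_split /=.
apply: ler_sum => s _.
have [vs|/piD ->] := boolP (valid s); last by do 2!case: ifP => _; rewrite addr0.
case: ifPn => [_|ngood]; first by rewrite lerDl; case: ifP.
rewrite ifT ?add0r //; apply: contraR ngood; rewrite negb_exists => /forallP low.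
have lb (r : 'I_M) : lam N alpha * v mu p r - theta M mu p r * L / sN <= Sim s 1 r.
  have := low r; rewrite -leNgt => Hr.
  have v_gt0 i : (i < M)%N -> 0 < v mu p i by move=> iM; apply: lt_le_trans (v_ge i iM).
  have := lowgapE v_gt0 (ltn_ord r) Hr; rewrite occE; apply: le_trans.
  rewrite subKr /theta -/C /eps le_eqVlt; apply/orP; left; apply/eqP.
  by field; rewrite !gt_eqF.
rewrite /good /= lb /=.
have le1 : \sum_(r < M) Sim s 1 r <= 1 :> R.
  have := sum_occ_le1 (R := R) N_gt0 vs; rewrite big_mkord.
  by under eq_bigr do rewrite occE.
(* The upper bound follows by subtracting the other lower bounds from the total 1, as
   [1 - lam * (1 - v m) = nu + lam * v m]. *)
move: le1 v_sum; rewrite (bigD1 m) //= [X in X = 1](bigD1 m) //= => le1 vs1.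
have : \sum_(r < M | r != m) (lam N alpha * v mu p r - theta M mu p r * L / sN)
   <= \sum_(r < M | r != m) Sim s 1 r by apply: ler_sum.
rewrite sumrB -mulr_sumr -nuE.
have -> : \sum_(r < M | r != m) theta M mu p r * L / sN =
    (\sum_(r < M | r != m) theta M mu p r) * L / sN by rewrite !mulr_suml.
have -> : \sum_(r < M | r != m) v mu p r = 1 - v mu p m by lra.
by move: lamE le1; lra.
Qed.
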